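(* Let $\mathcal{A}$ be a central arrangement of hyperplanes in $V=\mathbb{K}^\ell$, let $H\in\mathcal{A}$ and $\mathcal{A}'=\mathcal{A}\setminus\{H\}$. If $\mathcal{A}'$ is free, then $\mathcal{A}$ is free or dual SPOG (dual strongly plus-one generated).
   Context: Let $\mathbb{K}$ be a field, $V=\mathbb{K}^\ell$, $S=\mathbb{K}[x_1,\dots,x_\ell]$ its coordinate ring, $\mathrm{Der}\,S=\bigoplus_i S\,\partial_{x_i}$, $\Omega^1_V=\bigoplus_i S\,dx_i$, $\Omega^p_V=\bigwedge^p\Omega^1_V$. A central arrangement $\mathcal{A}$ is a finite set of linear hyperplanes in $V$; for each $H\in\mathcal{A}$ fix $\alpha_H\in V^*$ with $\ker\alpha_H=H$, and let $Q(\mathcal{A})=\prod_{H\in\mathcal{A}}\alpha_H$. Put $$D(\mathcal{A})=\{\theta\in\mathrm{Der}\,S\mid\theta(\alpha_H)\in S\alpha_H\ \forall H\in\mathcal{A}\},$$ $$\Omega^1(\mathcal{A})=\Big\{\omega\in\tfrac{1}{Q(\mathcal{A})}\Omega^1_V\ \Big|\ \omega\wedge d\alpha_H\in\tfrac{\alpha_H}{Q(\mathcal{A})}\Omega^2_V\ \forall H\in\mathcal{A}\Big\},$$ which are mutually dual reflexive graded $S$-modules of rank $\ell$ (with $\partial_{x_i}$ and $dx_i$ in degree $0$). $\mathcal{A}$ is free if $D(\mathcal{A})$ (equivalently $\Omega^1(\mathcal{A})$) is a free $S$-module. $S[d]$ denotes the graded free module with $S[d]_k=S_{d+k}$. A graded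 $S$-module $M$ of rank $\ell$ is strongly plus-one generated (SPOG) if it has a minimal graded free resolution of the form $$0\to S[d-1]\xrightarrow{(f_1,\dots,f_\ell,\alpha)}\bigoplus_{i=1}^\ell S[d_i]\oplus S[d]\to M\to0$$ with $d,d_i\in\mathbb{Z}$, $f_i\in S$ and $0\ne\alpha\in V^*$ (a nonzero linear form). $\mathcal{A}$ is dual SPOG if $\Omega^1(\mathcal{A})$ is an SPOG module. *)

(* Defs.v *)
From HB Require Import structures.
From mathcomp Require Import all_boot all_order all_algebra.
From mathcomp Require Import finmap.
From mathcomp.multinomials Require Import mpoly.

Set Implicit Arguments.
Unset Strict Implicit.
Unset Printing Implicit Defensive.

Import GRing.Theory.
Local Open Scope ring_scope.

(* Submodules of an R-module U are predicates U -> Prop.  Freeness only asks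
   for a finite basis; it is applied to submodules of a Noetherian module. *)
Definition free_submodule (R : comNzRingType) (U : lmodType R) (M : U -> Prop) :
    Prop :=
  exists (n : nat) (e : 'I_n -> U),
    (forall i, M (e i)) /\
    forall u, M u -> exists! c : 'rV[R]_n, u = \sum_(i < n) c 0 i *: e i.

Section GradedModules.
Variables (K : fieldType) (l : nat).
Local Notation S := {mpoly K[l]}.

(* The graded piece S_k, which is 0 for k < 0. *)
Definition poly_deg (k : int) (p : S) : Prop :=
  match k with
  | Posz n => p \is n.-homog
  | Negz _ => p = 0
  end.

(* The graded piece of degree k of the direct sum of the S[d_i], i < n. *)
Definition shifted_deg n (d : 'rV[int]_n) (k : int) (v : 'rV[S]_n) : Prop :=
  forall i, poly_deg (d 0 i + k) (v 0 i).

(* The sequence 0 -> \bigoplus_i S[d1_i] --B--> \bigoplus_j S[d0_j] --phi--> M -> 0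
   is a minimal graded free resolution of the submodule M of U, graded by deg;
   B acts on row vectors on the right.  Minimality: the image of B lies in
   (x_1, ..., x_l) times the target, i.e. its entries have no constant term. *)
Definition minimal_graded_resolution (U : lmodType S)
    (deg : int -> U -> Prop) (M : U -> Prop)
    m n (d1 : 'rV[int]_m) (d0 : 'rV[int]_n)
    (B : 'M[S]_(m, n)) (phi : {linear 'rV[S]_n -> U}) : Prop :=
  [/\ (forall k v, shifted_deg d1 k v -> shifted_deg d0 k (v *m B))
      /\ (forall k v, shifted_deg d0 k v -> deg k (phi v)),
      injective (fun v : 'rV[S]_m => v *m B),
      forall v, phi v = 0 <-> exists u : 'rV[S]_m, v = u *m B,
      forall u, M u <-> exists v, u = phi v
    & forall (u : 'rV[S]_m) j, ((u *m B) 0 j)@_0%MM = 0].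

(* A linear form on K^l as an element of its coordinate ring. *)
Definition linear_poly (a : 'Hom('rV[K]_l, K^o)) : S :=
  \sum_(i < l) (a (delta_mx 0 i) : K) *: 'X_i.

Definition SPOG (U : lmodType S) (deg : int -> U -> Prop) (M : U -> Prop) :
    Prop :=
  exists (d : int) (ds : 'rV[int]_l) (f : 'rV[S]_l)
         (a : 'Hom('rV[K]_l, K^o)) (phi : {linear 'rV[S]_(l + 1) -> U}),
    a != 0 /\
    minimal_graded_resolution deg M
      (const_mx (d - 1) : 'rV[int]_1)
      (row_mx ds (const_mx d : 'rV[int]_1))
      (row_mx f (const_mx (linear_poly a) : 'rV[S]_1)) phi.

End GradedModules.

(* Rational 1-forms \sum_i w_i dx_i with w_i in Frac S.  The alias carries the
   S-module structure obtained by restriction of scalars. *)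
Definition rat_form1 (K : fieldType) (l : nat) : Type :=
  'rV[{fraction {mpoly K[l]}}]_l.

Section RationalForms.
Variables (K : fieldType) (l : nat).
Local Notation S := {mpoly K[l]}.
Local Notation F := {fraction {mpoly K[l]}}.

HB.instance Definition _ := GRing.Zmodule.on (rat_form1 K l).

Definition rat_form1_scale (p : S) (w : rat_form1 K l) : rat_form1 K l :=
  (tofrac p : F) *: (w : 'rV[F]_l).

Fact rat_form1_scaleA p q w :
  rat_form1_scale p (rat_form1_scale q w) = rat_form1_scale (p * q) w.
Proof. by rewrite /rat_form1_scale scalerA rmorphM. Qed.

Fact rat_form1_scale1 : left_id 1 rat_form1_scale.
Proof. by move=> w; rewrite /rat_form1_scale rmorph1 scale1r. Qed.

Fact rat_form1_scaleDr : right_distributive rat_form1_scale +%R.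
Proof. by move=> p v w; rewrite /rat_form1_scale scalerDr. Qed.

Fact rat_form1_scaleDl w : {morph rat_form1_scale^~ w : p q / p + q}.
Proof. by move=> p q; rewrite /rat_form1_scale rmorphD scalerDl. Qed.

HB.instance Definition _ := GRing.Zmodule_isLmodule.Build S (rat_form1 K l)
  rat_form1_scaleA rat_form1_scale1 rat_form1_scaleDr rat_form1_scaleDl.

(* The dx_i have degree 0. *)
Definition rat_deg (k : int) (x : F) : Prop :=
  exists (p q : S) (m n : nat),
    [/\ p \is m.-homog, q \is n.-homog, q != 0,
        k = m%:Z - n%:Z & x = tofrac p / tofrac q].

Definition rat_form1_deg (k : int) (w : rat_form1 K l) : Prop :=
  forall i, rat_deg k ((w : 'rV[F]_l) 0 i).

Definition dpoly (p : S) : 'rV[S]_l := \row_(i < l) p^`M(i).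

(* A 2-form is the alternating matrix of its coefficients: the (i, j) entry,
   i < j, is the coefficient of dx_i /\ dx_j. *)
Definition wedge11 (R : comNzRingType) (v w : 'rV[R]_l) : 'M[R]_l :=
  \matrix_(i < l, j < l) (v 0 i * w 0 j - v 0 j * w 0 i).

Definition alternating (R : comNzRingType) (B : 'M[R]_l) : Prop :=
  (forall i, B i i = 0) /\ (forall i j, B j i = - B i j).

End RationalForms.

Section Arrangements.
Variables (K : fieldType) (l : nat).
Local Notation S := {mpoly K[l]}.
Local Notation F := {fraction {mpoly K[l]}}.
Local Notation V := 'rV[K]_l.

Definition central_arrangement (A : {fset {vspace V}}) : Prop :=
  forall H, H \in A -> (\dim H).+1 = l.

Definition defining_forms (A : {fset {vspace V}})
    (alpha : {vspace V} -> 'Hom(V, K^o)) : Prop :=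
  forall H, H \in A -> lker (alpha H) = H.

Variables (alpha : {vspace V} -> 'Hom(V, K^o)) (A : {fset {vspace V}}).

Definition defining_poly : S := \prod_(H <- A) linear_poly (alpha H).

(* The derivation \sum_i theta_i \partial_{x_i} applied to p. *)
Definition der_apply (theta : 'rV[S]_l) (p : S) : S :=
  \sum_(i < l) theta 0 i * p^`M(i).

Definition log_der (theta : 'rV[S]_l) : Prop :=
  forall H, H \in A ->
    exists g : S, der_apply theta (linear_poly (alpha H))
                  = g * linear_poly (alpha H).

Definition log_form1 (w : rat_form1 K l) : Prop :=
  (exists eta : 'rV[S]_l,
     (w : 'rV[F]_l) = (tofrac defining_poly)^-1 *: map_mx (@tofrac S) eta) /\
  forall H, H \in A ->
    exists2 B : 'M[S]_l, alternating B &
      wedge11 (w : 'rV[F]_l) (map_mx (@tofrac S) (dpoly (linear_poly (alpha H))))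
      = (tofrac (linear_poly (alpha H)) / tofrac defining_poly)
          *: map_mx (@tofrac S) B.

Definition free_arrangement : Prop := free_submodule log_der.

Definition dual_SPOG : Prop := SPOG (@rat_form1_deg K l) log_form1.

End Arrangements.

(* Main.v *)
(* Write alpha = alpha_H, A' = A \ H, and let theta_1, ..., theta_l be a
   homogeneous basis of D(A'), with dual basis omega_1, ..., omega_l of
   Omega^1(A').  A derivation sum_i c_i theta_i is in D(A) iff alpha divides
   sum_i c_i theta_i(alpha).  As S/alpha is again a polynomial ring, hence
   factorial, the classes of the theta_i(alpha) have a gcd there, and after
   dividing by it the condition becomes: alpha divides sum_i c_i h_i, with
   h_1, ..., h_l coprime modulo alpha.  By duality sum_i (p_i / alpha) omega_i
   is in Omega^1(A) iff p is parallel to h modulo alpha, hence, by coprimality, a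
   multiple of h modulo alpha.  So Omega^1(A) is generated by the omega_i and
   psi = -(sum_i h_i omega_i) / alpha with the single relation
   sum_i h_i omega_i + alpha psi = 0.  This presentation is minimal unless some
   h_i is a nonzero constant, and in that case A is free. *)
Require Import Defs.
From HB Require Import structures.
From mathcomp Require Import all_boot all_order all_algebra.
From mathcomp Require Import finmap.
From mathcomp.multinomials Require Import mpoly.
From Stdlib Require Import Classical ClassicalEpsilon.

Set Implicit Arguments.
Unset Strict Implicit.
Unset Printing Implicit Defensive.

Import GRing.Theory.
Local Open Scope ring_scope.

Lemma exists_choice (T U : Type) (P : T -> U -> Prop) :
  (forall x, exists y, P x y) -> exists f : T -> U, forall x, P x (f x).
Proof.
move=> Pex; exists (fun x => proj1_sig (constructive_indefinite_description _ (Pex x))).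
by move=> x; apply: proj2_sig.
Qed.
Arguments exists_choice [T U] P _.

(** * Factorial rings *)

Section Divisibility.
Variable R : idomainType.
Implicit Types a b c d p x y : R.

Definition divides d x := exists q, x = q * d.

Definition invertible x := exists y, y * x = 1.

Definition prime_elt p :=
  [/\ p != 0, ~ invertible p
    & forall x y, divides p (x * y) -> divides p x \/ divides p y].

Inductive prime_product : R -> Prop :=
| PrimeProductUnit u : invertible u -> prime_product u
| PrimeProductMul p a : prime_elt p -> prime_product a -> prime_product (p * a).

(** Factors are prime, not merely irreducible, so uniqueness of factorisations is automatic and this
    is the UFD property. *)
Definition factorial := forall a, a != 0 -> prime_product a.

Lemma dividesMl d x y : divides d y -> divides d (x * y).
Proof. by case=> q ->; exists (x * q); rewrite mulrA. Qed.

Lemma dividesMr d x y : divides d x -> divides d (x * y).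
Proof. by rewrite mulrC; apply: dividesMl. Qed.

Lemma dividesD d x y : divides d x -> divides d y -> divides d (x + y).
Proof. by case=> q -> [r ->]; exists (q + r); rewrite mulrDl. Qed.

Lemma dividesN d x : divides d x -> divides d (- x).
Proof. by case=> q ->; exists (- q); rewrite mulNr. Qed.

Lemma dividesB d x y : divides d x -> divides d y -> divides d (x - y).
Proof. by move=> dx dy; apply/dividesD/dividesN. Qed.

Lemma divides0 d : divides d 0.
Proof. by exists 0; rewrite mul0r. Qed.

Lemma dividesxx d : divides d d.
Proof. by exists 1; rewrite mul1r. Qed.

Lemma divides_sum d I (s : seq I) (P : pred I) (F : I -> R) :
  (forall i, P i -> divides d (F i)) -> divides d (\sum_(i <- s | P i) F i).
Proof. move=> dF; elim/big_ind: _ => //; [exact: divides0 | exact: dividesD]. Qed.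

Lemma divides_prod d (I : eqType) (s : seq I) (F : I -> R) i :
  i \in s -> divides d (F i) -> divides d (\prod_(i <- s) F i).
Proof. by move=> si dF; rewrite (big_rem i) //=; apply: dividesMr. Qed.

Lemma invertible_divides u x : invertible u -> divides u x.
Proof. by case=> v vu; exists (x * v); rewrite -mulrA vu mulr1. Qed.

Lemma invertibleM x y : invertible x -> invertible y -> invertible (x * y).
Proof. by case=> u ux [v vy]; exists (v * u); rewrite -mulrA (mulrA u) ux mul1r. Qed.

Lemma prime_productM a b :
  prime_product a -> prime_product b -> prime_product (a * b).
Proof.
elim=> [u uu | p c pp _ IH] pb; last by rewrite -mulrA; constructor; auto.
elim: pb => [v uv | p c pp _ IH]; first by constructor; apply: invertibleM.
by rewrite mulrCA; constructor.
Qed.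

Lemma prime_divides_prod p (I : eqType) (s : seq I) (F : I -> R) :
  prime_elt p -> divides p (\prod_(i <- s) F i) ->
  exists2 i, i \in s & divides p (F i).
Proof.
case=> _ p1 pp; elim: s => [|i s IH]; rewrite ?big_nil ?big_cons.
  by case=> q /esym q1; case: p1; exists q.
case/pp=> [pi | /IH [k ks pk]]; first by exists i; rewrite ?mem_head.
by exists k; rewrite // inE ks orbT.
Qed.

(* A gcd of the family g, one of whose members is a, in a form that makes the
   gcd property usable without any further factorisation. *)
Lemma prime_product_gcd a I (g : I -> R) : prime_product a ->
  exists c b (h : I -> R), [/\ a = c * b, forall i, g i = c * h i
    & forall x, divides b x \/ exists i, ~ divides b (x * h i)].
Proof.
move=> pa; elim: pa g => [u uu | p a0 pp _ IH] g.
  exists 1, u, g; split=> [|i|x]; rewrite ?mul1r //.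
  by left; apply: invertible_divides.
have [p0 _ primeP] := pp.
(* A prime [p] dividing the whole family goes into the gcd [c]; otherwise it stays in the cofactor
   [b]. *)
have [pg | /not_all_ex_not [j pgj]] := classic (forall i, exists y, g i = p * y).
  have [g' g'P] : exists g' : I -> R, forall i, g i = p * g' i.
    by apply: exists_choice (fun i y => g i = p * y) pg.
  have [c [b [h [-> gh hP]]]] := IH g'.
  exists (p * c), b, h; split=> [|i|//]; first by rewrite mulrA.
  by rewrite g'P gh mulrA.
have [c [b [h [-> gh hP]]]] := IH g.
exists c, (p * b), h; split=> [|//|x]; first by rewrite mulrCA.
have [phx | /not_all_ex_not] := classic (forall i, divides (p * b) (x * h i)); last by right.
left.
(* [p] does not divide [h j], since it does not divide [g j]; hence it divides [x], and the
   induction hypothesis applies to the quotient. *)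
have : divides p (x * h j).
  by have [q qE] := phx j; exists (q * b); rewrite qE -mulrA (mulrC p).
case/primeP=> [[x' xE] | [q hq]]; last first.
  by case: pgj; exists (c * q); rewrite gh hq mulrA mulrC.
case: (hP x') => [[q qE] | [i []]].
  by exists q; rewrite xE qE -mulrA (mulrC b).
have [q qE] := phx i; exists q; apply: (mulIf p0).
by rewrite mulrAC -xE qE mulrA mulrAC.
Qed.

End Divisibility.

(** * Gauss's lemma and polynomial rings over factorial rings *)

Section Gauss.
Variable R : idomainType.
Implicit Types (a c d p : R) (f g h : {poly R}).
Hypothesis fR : factorial R.

Lemma divides_polyC c f :
  divides c%:P f <-> forall i, divides c f`_i.
Proof.
split=> [[q ->] i | /exists_choice [q qP]].
  by exists q`_i; rewrite coefMC.
by exists (\poly_(i < size f) q i); apply/polyP=> i; rewrite coefMC coef_poly qP;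
  case: ltnP => // fi; rewrite -qP nth_default ?mul0r.
Qed.

(** If [p] divides neither factor, take in each the first coefficient it does not divide: modulo
    [p], their product is the coefficient of the product at the sum of the two indices. *)
Lemma prime_elt_polyC p : prime_elt p -> prime_elt p%:P.
Proof.
case=> p0 p1 pp; split; first by rewrite polyC_eq0.
  case=> q /(congr1 (coefp 0)); rewrite /= coefMC coefC eqxx => qp.
  by case: p1; exists q`_0.
move=> f g pfg; apply: NNPP => /not_or_and [].
have minimal h : ~ divides p%:P h ->
    exists i, ~ divides p h`_i /\ forall j, (j < i)%N -> divides p h`_j.
  move=> nph; have [i ni] : exists i, ~ divides p h`_i.
    by apply: not_all_ex_not => ph; apply/nph/divides_polyC.
  elim/ltn_ind: i ni => i IH ni.
  have [[j [ji nj]] | none] := classic (exists j, (j < i)%N /\ ~ divides p h`_j).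
    exact: IH ji nj.
  by exists i; split=> // j ji; apply: NNPP => nj; apply: none; exists j.
case/minimal=> i [fi fj] /minimal [k [gk gj]].
have ik : (i < (i + k).+1)%N by rewrite ltnS leq_addr.
have := proj1 (divides_polyC _ _) pfg (i + k)%N.
rewrite coefM (bigD1 (Ordinal ik)) //= addKn => sfg.
suff /pp [] : divides p (f`_i * g`_k) by [].
rewrite -[_ * _](addrK (\sum_(j < (i + k).+1 | j != Ordinal ik) f`_j * g`_(i + k - j))).
apply: dividesB sfg _; apply: divides_sum => j.
rewrite -val_eqE /= neq_ltn => /orP [/fj | ij]; first exact: dividesMr.
by apply/dividesMl/gj; rewrite ltn_subLR ?ltn_add2r // -ltnS ltn_ord.
Qed.

(** Clears a denominator: each prime of [a] stays prime over the polynomials, so it divides [g] or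
    [h] and is cancelled there without changing degrees. *)
Lemma factorial_descent a f g h : prime_product a -> a%:P * f = g * h ->
  exists g' h', [/\ f = g' * h', size g' = size g & size h' = size h].
Proof.
move=> pa; elim: pa f g h => [u [v vu] | p b pp _ IH] f g h E.
  have v0 : v != 0 by apply: contra_eq_neq vu => ->; rewrite mul0r eq_sym oner_neq0.
  exists (v%:P * g), h; split=> //; last by rewrite size_Cmul.
  by rewrite -mulrA -E mulrA -polyCM vu mul1r.
have [p0 _ prP] := prime_elt_polyC pp.
have : divides p%:P (g * h) by rewrite -E polyCM -mulrA mulrC; exists (b%:P * f).
rewrite polyC_eq0 in p0.
case/prP=> [[g0 gE] | [h0 hE]].
  have [|g' [h' [-> sg sh]]] := IH f g0 h.
    apply: (mulfI (x := p%:P)); first by rewrite polyC_eq0.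
    by rewrite mulrA -polyCM E gE; rewrite mulrA (mulrC p%:P).
  by exists g', h'; rewrite gE (mulrC g0) size_Cmul.
have [|g' [h' [-> sg sh]]] := IH f g h0.
  apply: (mulfI (x := p%:P)); first by rewrite polyC_eq0.
  by rewrite mulrA -polyCM E hE mulrA mulrC.
by exists g', h'; rewrite hE (mulrC h0) size_Cmul.
Qed.

Definition primitive f := forall p, prime_elt p -> ~ divides p%:P f.

(** The primes of [a] do not divide the primitive [f], so they divide [h] and cancel one by one. *)
Lemma primitive_divides a f g h : prime_product a -> primitive f ->
  a%:P * g = h * f -> divides f g.
Proof.
move=> pa pf; elim: pa g h => [u [v vu] | p b pp _ IH] g h E.
  by exists (v%:P * h); rewrite -mulrA -E mulrA -polyCM vu mul1r.
have [p0 _ prP] := prime_elt_polyC pp.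
have : divides p%:P (h * f) by rewrite -E polyCM -mulrA mulrC; exists (b%:P * g).
case/prP=> [[h0 hE] | /(pf _ pp) //]; apply: (IH g h0).
by apply: (mulfI p0); rewrite mulrA -polyCM E hE mulrA (mulrC p%:P).
Qed.

Lemma primitive_part f : f != 0 ->
  exists c g, [/\ c != 0, f = c%:P * g & primitive g].
Proof.
move=> f0; have l0 : lead_coef f != 0 by rewrite lead_coef_eq0.
have [c [b [h [lE fE hP]]]] := prime_product_gcd (fun i => f`_i) (fR l0).
have c0 : c != 0 by apply: contraNneq l0 => c0; rewrite lE c0 mul0r.
have b0 : b != 0 by apply: contraNneq l0 => b0; rewrite lE b0 mulr0.
have fg : f = c%:P * \poly_(i < size f) h i.
  apply/polyP=> i; rewrite coefCM coef_poly fE; case: ltnP => // fi.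
  by rewrite -fE nth_default ?mulr0.
exists c, (\poly_(i < size f) h i); split=> // p [p0 p1 _] /divides_polyC ph.
have hh i : divides p (h i).
  have := ph i; rewrite coef_poly; case: ltnP => // fi _.
  suff -> : h i = 0 by apply: divides0.
  by apply: (mulfI c0); rewrite -fE nth_default ?mulr0.
(* At the leading index [h] equals [b], so [p] divides [b]; the quotient of [b] by [p] then
   contradicts the gcd property [hP]. *)
have [q qE] : divides p b.
  have -> : b = h (size f).-1 by apply: (mulfI c0); rewrite -fE -lE.
  exact: hh.
case: (hP q) => [[r rE] | [i []]].
  case: p1; exists r; apply: (mulIf b0).
  by rewrite mul1r mulrAC -rE qE.
by have [r ->] := hh i; exists r; rewrite qE mulrCA.
Qed.

(** A gcd [d] of [f] and [g] over the fraction field, or its cofactor in [f], must be constant. A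
    constant cofactor makes [f] divide [g]; a constant [d] makes [f] divide [h]. Both hold first up
    to a scalar, which primitivity removes. *)
Lemma primitive_prime f : (1 < size f)%N -> primitive f ->
  (forall g h, f = g * h -> (size g <= 1)%N \/ (size h <= 1)%N) -> prime_elt f.
Proof.
move=> sf pf irr; have f0 : f != 0 by rewrite -size_poly_gt0 ltnW.
split=> // [[g gf] | g h [k ghE]].
  have g0 : g != 0 by apply: contra_eq_neq gf => ->; rewrite mul0r eq_sym oner_neq0.
  have := congr1 (fun q : {poly R} => size q) gf.
  rewrite /= size_mul // size_poly1 => sgf.
  have : (0 < size g)%N by rewrite size_poly_gt0.
  by case: (size g) (size f) sgf sf => [|m] [|[|n]] //; rewrite !addnS.
have [->|g0] := eqVneq g 0; first by left; apply: divides0.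
have := dvdp_gcdl f g; have := dvdp_gcdr f g.
move: (@coprimep_def _ f g); set d := gcdp f g => cop.
case/Pdiv.Idomain.dvdpP=> [[c1 r1]] /= c10 E1 /Pdiv.Idomain.dvdpP [[c2 r2]] /= c20 E2.
have [g' [h' [fE sg sh]]] : exists g' h', [/\ f = g' * h', size g' = size r2 & size h' = size d].
  by apply: (factorial_descent (fR c20)); rewrite mul_polyC.
have [] := irr _ _ fE; rewrite ?sg ?sh => sz.
  left; have r2E := size1_polyC sz.
  have r20 : r2`_0 != 0.
    apply: contraNneq f0 => r0; rewrite r0 in r2E.
    by move/eqP: E2; rewrite /= r2E polyC0 mul0r -mul_polyC mulf_eq0 polyC_eq0 (negbTE c20).
  apply: (@primitive_divides (c1 * r2`_0) f g (r1 * c2%:P)) => //.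
    by apply: fR; rewrite mulf_neq0.
  rewrite polyCM -r2E -mulrA (mulrC r2) mulrA [c1%:P * g]mul_polyC E1 -!mulrA.
  by congr (_ * _); rewrite mulrC -E2 mul_polyC.
right; have d1 : size d == 1%N.
  rewrite eqn_leq sz size_poly_gt0 /d gcdp_eq0 negb_and f0 //.
rewrite -cop in d1.
have : f %| g * h by rewrite ghE dvdp_mull.
rewrite Gauss_dvdpr // => /Pdiv.Idomain.dvdpP [[c r]] /= c0 E.
by apply: (primitive_divides (fR c0) pf); rewrite mul_polyC E.
Qed.

(** Induction on the degree: the content factors over [R], and the primitive part is constant,
    prime, or a product of two factors of smaller degree. *)
Lemma factorial_poly : factorial {poly R}.
Proof.
have polyC_pp a : prime_product a -> prime_product a%:P.
  elim=> [u [v vu] | p b pp _ IH].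
    by constructor; exists v%:P; rewrite -polyCM vu.
  by rewrite polyCM; constructor=> //; apply: prime_elt_polyC.
move=> f; have [n] := ubnP (size f); elim: n f => // n IH f sf f0.
have [c [g [c0 fE pg]]] := primitive_part f0.
have szg : size f = size g by rewrite fE size_Cmul.
have g0 : g != 0 by apply: contraNneq f0 => g0; rewrite fE g0 mulr0.
rewrite fE; apply: prime_productM; first exact/polyC_pp/fR.
have [sg | sg] := leqP (size g) 1.
  rewrite (size1_polyC sg); apply/polyC_pp/fR.
  by rewrite -polyC_eq0 -(size1_polyC sg).
have [[u [v [gE su sv]]] | irr] :=
  classic (exists u v, [/\ g = u * v, (1 < size u)%N & (1 < size v)%N]); last first.
  rewrite -[g]mulr1; constructor; last by constructor; exists 1; rewrite mulr1.
  apply: primitive_prime => // u v gE.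
  have [su | su] := leqP (size u) 1; [by left | right].
  by rewrite leqNgt; apply/negP=> sv; apply: irr; exists u, v.
have u0 : u != 0 by rewrite -size_poly_gt0 ltnW.
have v0 : v != 0 by rewrite -size_poly_gt0 ltnW.
have suv : size f = (size u + size v).-1 by rewrite szg gE size_mul.
rewrite ltnS in sf; rewrite gE; apply: prime_productM; apply: IH => //.
  apply: leq_trans sf; rewrite suv.
  by rewrite -subn1 ltn_subRL addnC ltn_add2l.
apply: leq_trans sf; rewrite suv.
by rewrite -subn1 ltn_subRL ltn_add2r.
Qed.

End Gauss.

(** * Factoriality of multivariate polynomial rings *)

Lemma factorial_iso (R R' : idomainType) (f : {rmorphism R -> R'}) (g : R' -> R) :
  cancel f g -> cancel g f -> factorial R' -> factorial R.
Proof.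
move=> fK gK fR' a a0.
have gM : {morph g : x y / x * y}.
  by move=> x y; apply: (can_inj fK); rewrite rmorphM !gK.
have g1 : g 1 = 1 by apply: (can_inj fK); rewrite rmorph1 gK.
have g0 : g 0 = 0 by apply: (can_inj fK); rewrite rmorph0 gK.
have inv x : invertible x -> invertible (g x).
  by case=> y yx; exists (g y); rewrite -gM yx.
have fa0 : f a != 0 by apply: contraNneq a0 => fa; rewrite -[a]fK fa g0.
rewrite -[a]fK; elim: {fa0}(fR' _ fa0) => [u /inv | p b [p0 p1 pp] _ IH]; first by constructor.
rewrite gM; constructor=> //; split=> [|[y yp]|x y [q xyE]].
- by apply: contraNneq p0 => gp; rewrite -[p]gK gp rmorph0.
- by case: p1; exists (f y); rewrite -[p]gK -rmorphM yp rmorph1.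
have : divides p (f x * f y) by exists (f q); rewrite -rmorphM xyE rmorphM gK.
by case/pp=> [] [r rE]; [left | right]; exists (g r); rewrite -gM -rE fK.
Qed.

Lemma mpoly_gen_ind n (R : comNzRingType) (P : {mpoly R[n]} -> Prop) :
  (forall c, P c%:MP) -> (forall i, P 'X_i) ->
  (forall p q, P p -> P q -> P (p + q)) ->
  (forall p q, P p -> P q -> P (p * q)) -> forall p, P p.
Proof.
move=> PC PX PD PM p; rewrite [p]mpolyE.
elim/big_ind: _ => [||m _]; [by rewrite -mpolyC0 | exact: PD |].
rewrite -mul_mpolyC; apply: (PM) => //; rewrite mpolyXE_id.
elim/big_ind: _ => [||i _]; [by rewrite -mpolyC1 | exact: PM |].
elim: (m i) => [|k IH]; first by rewrite expr0 -mpolyC1.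
by rewrite exprS; apply: PM.
Qed.

Lemma mpoly0_factorial (K : fieldType) : factorial {mpoly K[0]}.
Proof.
move=> p p0; constructor.
have pC : p = (p@_0%MM)%:MP.
  by apply: msize1_polyC; rewrite msizeE; apply/bigmax_leqP_seq => m _ _;
    rewrite mdegE big_ord0.
exists ((p@_0%MM)^-1)%:MP; rewrite [X in _ * X]pC -mpolyCM mulVf ?mpolyC1 //.
by apply: contraNneq p0 => p00; rewrite pC p00 mpolyC0.
Qed.

Section MuniIso.
Variables (n : nat) (R : comNzRingType).
Local Notation widen := (widen_ord (leqnSn n)).

Let muniX i : muni ('X_(widen i) : {mpoly R[n.+1]}) = ('X_i)%:P.
Proof.
rewrite muniE msuppX big_seq1 mcoeffX eqxx scale1r mnm1E.
rewrite (_ : _ == _ = false) ?expr0 ?alg_polyC; last first.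
  by apply/negbTE; rewrite -val_eqE /= neq_ltn ltn_ord.
congr ('X_[_])%:P; apply/mnmP=> j; rewrite mnmE !mnm1E.
by rewrite -!val_eqE.
Qed.

Let muniXmax : muni ('X_ord_max : {mpoly R[n.+1]}) = 'X.
Proof.
rewrite muniE msuppX big_seq1 mcoeffX eqxx scale1r mnm1E eqxx expr1.
rewrite (_ : [multinom _ | i < n] = 0%MM) ?mpolyX0 ?scale1r //.
apply/mnmP=> j; rewrite mnmE mnm1E mnm0E.
by apply/eqP; rewrite eqb0 -val_eqE /= neq_ltn ltn_ord orbT.
Qed.

(** The inverse of [muni], composed of ring morphisms so that additivity and multiplicativity are
    inherited. *)
Definition muni_inv (p : {poly {mpoly R[n]}}) : {mpoly R[n.+1]} :=
  (horner_eval 'X_ord_max \o map_poly (@mwiden n R)) p.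

Let muni_invD : {morph muni_inv : p q / p + q}.
Proof. exact: rmorphD. Qed.

Let muni_invM : {morph muni_inv : p q / p * q}.
Proof. exact: rmorphM. Qed.

Let muni_invC p : muni_inv p%:P = mwiden p.
Proof. by rewrite /muni_inv /= map_polyC /= horner_evalE hornerC. Qed.

Let muni_invX : muni_inv 'X = 'X_ord_max.
Proof. by rewrite /muni_inv /= map_polyX horner_evalE hornerX. Qed.

Let mwidenX1 i : mwiden ('X_i : {mpoly R[n]}) = 'X_(widen i).
Proof. by rewrite mwidenX mnmwiden1. Qed.

Lemma muniK : cancel (@muni n R) muni_inv.
Proof.
move=> p; elim/mpoly_gen_ind: p => [c|i|p q IHp IHq|p q IHp IHq].
- by rewrite muniC muni_invC mwidenC.
- have [[j ->]|->] : (exists j, i = widen j) \/ i = ord_max.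
  + have [ni|ni] := ltnP i n; [left | right].
      by exists (Ordinal ni); apply/val_inj.
    by apply/val_inj/eqP; rewrite eqn_leq /= ni -ltnS ltn_ord.
  + by rewrite muniX muni_invC mwidenX1.
  by rewrite muniXmax muni_invX.
- by rewrite muniD muni_invD; congr (_ + _); [exact: IHp | exact: IHq].
by rewrite muniM muni_invM; congr (_ * _); [exact: IHp | exact: IHq].
Qed.

Lemma muni_invK : cancel muni_inv (@muni n R).
Proof.
have muni_widen (p : {mpoly R[n]}) : muni (mwiden p) = p%:P.
  elim/mpoly_gen_ind: p => [c|i|p q IHp IHq|p q IHp IHq].
  - by rewrite mwidenC muniC.
  - by rewrite mwidenX1 muniX.
  - by rewrite mwidenD muniD IHp IHq polyCD.
  by rewrite mwidenM muniM IHp IHq polyCM.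
elim/poly_ind=> [|p c IH]; first by rewrite -polyC0 muni_invC mwiden0 muni0.
by rewrite muni_invD muni_invM muni_invX muni_invC muniD muniM IH muniXmax muni_widen.
Qed.

End MuniIso.

Lemma mpoly_factorial n (K : fieldType) : factorial {mpoly K[n]}.
Proof.
elim: n => [|n IH]; first exact: mpoly0_factorial.
exact: factorial_iso (@muniK n K) (@muni_invK n K) (factorial_poly IH).
Qed.

(** * Factors of homogeneous polynomials *)

Section Homogeneous.
Variables (n : nat) (K : idomainType).
Local Notation S := {mpoly K[n]}.
Implicit Types p q : S.

Lemma dhomog_sum d I (s : seq I) (P : pred I) (F : I -> S) :
  (forall i, P i -> F i \is d.-homog) -> \sum_(i <- s | P i) F i \is d.-homog.
Proof. by move=> hF; apply: rpred_sum. Qed.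

Lemma dhomog_bigprod I (s : seq I) (F : I -> S) (d : I -> nat) :
  (forall i, F i \is (d i).-homog) ->
  \prod_(i <- s) F i \is (\sum_(i <- s) d i).-homog.
Proof.
move=> hF; elim/big_ind2: _ => [||//]; first exact: dhomog1.
by move=> p d1 q d2; apply: dhomogM.
Qed.

(** While the exponent is positive, 0 is a root of [f * g], so ['X] splits off one of the factors;
    at exponent 0 both are constant. *)
Lemma mul_monomial_inv (R : idomainType) d (f g : {poly R}) c : c != 0 ->
  f * g = c *: 'X^d ->
  exists a b e, [/\ (e <= d)%N, f = a *: 'X^e & g = b *: 'X^(d - e)].
Proof.
move=> c0; elim: d f g => [|d IH] f g E.
  have : size (f * g) = 1%N by rewrite E expr0 alg_polyC size_polyC c0.
  have f0 : f != 0.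
    by apply: contra_eq_neq E => ->; rewrite mul0r eq_sym -mul_polyC expr0 mulr1 polyC_eq0.
  have g0 : g != 0.
    by apply: contra_eq_neq E => ->; rewrite mulr0 eq_sym -mul_polyC expr0 mulr1 polyC_eq0.
  rewrite size_mul // => sfg; exists f`_0, g`_0, 0%N.
  have : (0 < size f)%N by rewrite size_poly_gt0.
  have : (0 < size g)%N by rewrite size_poly_gt0.
  rewrite !expr0 !alg_polyC => sg sf; split=> //; apply: size1_polyC.
    by rewrite -sfg -subn1 leq_subRL ?addn_gt0 ?sf // addnC leq_add2l.
  by rewrite -sfg -subn1 leq_subRL ?addn_gt0 ?sf // leq_add2r.
have : root (f * g) 0 by rewrite /root E hornerZ hornerXn expr0n mulr0.
rewrite rootM => /orP [] /factor_theorem [h]; rewrite subr0 => hE.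
  have [|a [b [e [ed hm gm]]]] := IH h g.
    by apply: (mulIf (negbT (polyX_eq0 R))); rewrite -scalerAl -exprSr -E hE mulrAC.
  by exists a, b, e.+1; rewrite hE hm subSS -scalerAl -exprSr.
have [|a [b [e [ed fm hm]]]] := IH f h.
  by apply: (mulIf (negbT (polyX_eq0 R))); rewrite -scalerAl -exprSr -E hE mulrA.
by exists a, b, e; rewrite hE hm subSn // -scalerAl -exprSr leqW.
Qed.

(* Substituting x_i t for x_i turns homogeneous components into coefficients. *)
Let grade : S -> {poly S} := mmap (polyC \o @mpolyC n K) (fun i => ('X_i)%:P * 'X).

Let gradeE p d : (grade p)`_d = pihomog mdeg d p.
Proof.
rewrite /grade /mmap coef_sum pihomogE [RHS]big_mkcond /=; apply: eq_bigr => m _.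
rewrite (_ : mmap1 _ m = 'X_[m]%:P * 'X^(mdeg m)); last first.
  rewrite /mmap1 (eq_bigr (fun i => ('X_i ^+ m i)%:P * 'X^(m i))); last first.
    by move=> i _; rewrite exprMn rmorphXn.
  by rewrite big_split /= -rmorph_prod -mpolyXE_id prodrXr mdegE.
rewrite mulrA -polyCM coefCM coefXn mul_mpolyC eq_sym.
by case: eqP => _; rewrite ?mulr1 ?mulr0.
Qed.

Let grade_dhomog p d : p \is d.-homog -> grade p = p *: 'X^d.
Proof.
move=> hp; apply/polyP=> e; rewrite gradeE coefZ coefXn.
case: eqVneq => [->|ne]; rewrite ?mulr1 ?mulr0; first exact: pihomog_dE.
by apply: pihomog_ne0 hp; rewrite eq_sym.
Qed.

Let dhomog_grade p q d : grade p = q *: 'X^d -> p \is d.-homog.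
Proof.
move=> E; have pE k : k != d -> pihomog mdeg k p = 0.
  by move=> kd; rewrite -gradeE E coefZ coefXn (negbTE kd) mulr0.
rewrite [p](pihomog_partitionE (leqnn (mmeasure mdeg p))); apply: dhomog_sum => i _.
have [<-|/pE ->] := eqVneq (i : nat) d; first exact: pihomogP.
exact: dhomog0.
Qed.

(** [grade] is multiplicative and turns homogeneity of degree [d] into being a coefficient times
    ['X^d], so the factors of a monomial decide. *)
Lemma dhomog_factor d p q : p * q != 0 -> p * q \is d.-homog ->
  exists e, [/\ (e <= d)%N, p \is e.-homog & q \is (d - e).-homog].
Proof.
move=> pq0 /grade_dhomog; rewrite [LHS]rmorphM => /(mul_monomial_inv pq0).
by case=> a [b [e [ed pE qE]]]; exists e; split; [|exact: dhomog_grade pE|exact: dhomog_grade qE].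
Qed.

End Homogeneous.

(** * Linear forms *)

(** [c] is a gcd of the [g i] and [h] the coprime quotient vector. For one index [i] with [b = h i],
    parallelism makes [b] divide every [p i * h j], so coprimality makes it divide [p i]. *)
Lemma primitive_vector (R : idomainType) (n : nat) (g : 'I_n -> R) :
  factorial R -> (exists i, g i != 0) ->
  exists c (h : 'I_n -> R), [/\ c != 0, forall i, g i = c * h i
    & forall p : 'I_n -> R, (forall i j, h j * p i = h i * p j) ->
      exists t, forall i, p i = t * h i].
Proof.
move=> fR [i gi0]; have [c [b [h [gE ghE hP]]]] := prime_product_gcd g (fR _ gi0).
have c0 : c != 0 by apply: contraNneq gi0 => c0; rewrite gE c0 mul0r.
have hb : h i = b by apply: (mulfI c0); rewrite -ghE.
have b0 : b != 0 by apply: contraNneq gi0 => b0; rewrite gE b0 mulr0.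
exists c, h; split=> // p hp.
have [[t tE] | [j []]] := hP (p i); last by exists (p j); rewrite mulrC hp hb mulrC.
exists t => j; apply: (mulfI b0); rewrite -{1}hb -(hp i j) tE.
by rewrite mulrA mulrC (mulrC t).
Qed.

Section LinearForms.
Variables (K : fieldType) (l : nat).
Local Notation S := {mpoly K[l]}.
Local Notation V := 'rV[K]_l.
Local Notation form := 'Hom(V, K^o).
Implicit Types (a b : form) (p q : S).

Definition form_coef a i : K := a (delta_mx 0 i).

Lemma linear_polyE a : linear_poly a = \sum_(i < l) form_coef a i *: 'X_i.
Proof. by []. Qed.

Lemma form_coefE a (v : V) : (a v : K) = \sum_(i < l) v 0 i * form_coef a i.
Proof.
rewrite {1}[v]row_sum_delta linear_sum; apply: eq_bigr => i _.
by rewrite linearZ.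
Qed.

Lemma form_coef_neq0 a : a != 0 -> exists i, form_coef a i != 0.
Proof.
move=> a0; apply: NNPP => none; case/negP: a0; apply/eqP/lfunP => v.
rewrite lfunE /= [LHS]form_coefE big1 // => i _.
have [->|ai] := eqVneq (form_coef a i) 0; first by rewrite mulr0.
by case: none; exists i.
Qed.

Lemma linear_poly_homog a : linear_poly a \is 1.-homog.
Proof. by apply: dhomog_sum => i _; apply/dhomogZ; rewrite dhomogX /= mdeg1. Qed.

Lemma linear_poly_eval a (v : V) : (linear_poly a).@[fun i => v 0 i] = a v.
Proof.
rewrite linear_polyE rmorph_sum form_coefE; apply: eq_bigr => i _ /=.
by rewrite mevalZ mevalXU mulrC.
Qed.

Lemma linear_poly_mderiv a i : (linear_poly a)^`M(i) = (form_coef a i)%:MP.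
Proof.
rewrite linear_polyE raddf_sum (bigD1 i) //= big1 => [|j ji].
  rewrite mderivZ mderivX mnm1E eqxx scale1r addr0.
  by rewrite (_ : (U_(i) - U_(i) = 0)%MM) ?mpolyX0 ?alg_mpolyC //; apply/mnmP=> k;
     rewrite mnmBE subnn mnm0E.
by rewrite mderivZ mderivX mnm1E (negbTE ji) scale0r scaler0.
Qed.

Lemma linear_poly_neq0 a : a != 0 -> linear_poly a != 0.
Proof.
case/form_coef_neq0=> i; apply: contraNneq => a0; apply/eqP.
by have := linear_poly_mderiv a i; rewrite a0 mderiv0 => /esym /eqP; rewrite mpolyC_eq0 => /eqP.
Qed.

Lemma linear_poly_divides_lker a b :
  divides (linear_poly a) (linear_poly b) -> (lker a <= lker b)%VS.
Proof.
case=> q E; apply/subvP=> v; rewrite !memv_ker -linear_poly_eval => /eqP av.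
by apply/eqP; rewrite -linear_poly_eval E rmorphM /= av mulr0.
Qed.

(* For a vector u with a(u) = 1, the substitution x |-> x - a(x) u is the
   projection of V onto the hyperplane along u. *)
Lemma hyperplane_retraction a : a != 0 -> exists pi : {rmorphism S -> S},
  [/\ pi (linear_poly a) = 0, forall p, divides (linear_poly a) (p - pi p)
    & forall d p, p \is d.-homog -> pi p \is d.-homog].
Proof.
move=> /form_coef_neq0 [k ak].
pose u i := (i == k)%:R / form_coef a k.
pose x : l.-tuple S := [tuple 'X_i - u i *: linear_poly a | i < l].
have xE i : tnth x i = 'X_i - u i *: linear_poly a by rewrite tnth_mktuple.
have piX i : 'X_i \mPo x = 'X_i - u i *: linear_poly a.
  by rewrite comp_mpolyXU -tnth_nth xE.
exists (comp_mpoly x : {rmorphism S -> S}); split.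
- rewrite /= {1}linear_polyE raddf_sum /=.
  under eq_bigr => i _ do rewrite comp_mpolyZ piX scalerBr scalerA.
  rewrite sumrB -linear_polyE -scaler_suml (bigD1 k) //= big1 => [|i ik].
    by rewrite addr0 /u eqxx mul1r mulfV // scale1r subrr.
  by rewrite /u (negbTE ik) mul0r mulr0.
- elim/mpoly_gen_ind=> [c|i|p q IHp IHq|p q IHp IHq] /=.
  + by rewrite comp_mpolyC subrr; apply: divides0.
  + by rewrite piX opprB addrC subrK -mul_mpolyC; exists (u i)%:MP.
  + by rewrite rmorphD opprD addrACA; apply: dividesD.
  rewrite rmorphM (_ : p * q - _ = p * (q - (q \mPo x)) + (p - (p \mPo x)) * (q \mPo x)).
    by apply: dividesD; [apply: dividesMl | apply: dividesMr].
  by rewrite mulrBr mulrBl addrA subrK.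
move=> d p /dhomogP hp /=; rewrite comp_mpolyEX big_seq; apply: dhomog_sum => m mp.
apply: dhomogZ; rewrite comp_mpolyX -(hp _ mp) /= mdegE.
apply: dhomog_bigprod => i; rewrite -[X in X.-homog]mul1n; apply: dhomogMn.
rewrite xE; apply: rpredB; first by rewrite dhomogX /= mdeg1.
exact/dhomogZ/linear_poly_homog.
Qed.

Section Retraction.
Variables (a : form) (pi : {rmorphism S -> S}).
Hypotheses (pi0 : pi (linear_poly a) = 0)
           (piP : forall p, divides (linear_poly a) (p - pi p)).

(** The image of [pi] thus models the quotient of [S] by the form: congruences become equations
    inside the domain [S]. *)
Lemma retraction_divides p : divides (linear_poly a) p <-> pi p = 0.
Proof.
split=> [[q ->]|pip]; first by rewrite rmorphM pi0 mulr0.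
by have := piP p; rewrite pip subr0.
Qed.

Lemma retraction_id p : pi (pi p) = pi p.
Proof.
by apply/esym/eqP; rewrite -subr_eq0 -rmorphB; apply/eqP/retraction_divides/piP.
Qed.

End Retraction.

(** The multiples of the form are the kernel of a ring morphism into a domain. *)
Lemma linear_poly_prime a : a != 0 -> prime_elt (linear_poly a).
Proof.
move=> a0; have [pi [pi0 piP _]] := hyperplane_retraction a0.
have divP := retraction_divides pi0 piP.
split=> [|[y ya]|p q]; first exact: linear_poly_neq0.
  have : pi 1 = 0 by rewrite -ya rmorphM pi0 mulr0.
  by rewrite rmorph1; apply/eqP/oner_neq0.
move/divP; rewrite rmorphM => /eqP; rewrite mulf_eq0.
by case/orP=> /eqP /divP; [left | right].
Qed.

End LinearForms.

(** * Duality between logarithmic derivations and forms *)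

Section LogDuality.
Variables (K : fieldType) (l : nat).
Local Notation S := {mpoly K[l]}.
Local Notation F := {fraction {mpoly K[l]}}.
Local Notation V := 'rV[K]_l.

(** By induction the product of the tail divides [x]; the head prime must divide the quotient, since
    otherwise it would divide another prime of the list. *)
Lemma prime_prod_divides (R : idomainType) (I : eqType) (s : seq I) (f : I -> R) x :
  uniq s -> {in s, forall i, prime_elt (f i)} ->
  {in s &, forall i j, divides (f i) (f j) -> i = j} ->
  {in s, forall i, divides (f i) x} -> divides (\prod_(i <- s) f i) x.
Proof.
elim: s => [|i s IH] /=; first by move=> *; exists x; rewrite big_nil mulr1.
case/andP=> is_ us fp fd fx; rewrite big_cons.
have [|||q xE] := IH us; first by move=> j js; apply: fp; rewrite inE js orbT.
- by move=> j k js ks; apply: fd; rewrite inE ?js ?ks orbT.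
- by move=> j js; apply: fx; rewrite inE js orbT.
have [_ _ fiP] := fp i (mem_head i s).
have := fx i (mem_head i s); rewrite xE => /fiP [[r ->]|].
  by exists r; rewrite mulrA.
case/(prime_divides_prod (fp i (mem_head i s))) => j js ij; case/negP: is_.
by rewrite (fd i j _ _ ij) // ?mem_head // inE js orbT.
Qed.

Definition integral (x : F) := exists p : S, x = tofrac p.

Definition pairing (theta : 'rV[S]_l) (w : 'rV[F]_l) : F :=
  \sum_(i < l) tofrac (theta 0 i) * w 0 i.

Lemma pairing_delta q i (w : 'rV[F]_l) :
  pairing (q *: delta_mx 0 i) w = tofrac q * w 0 i.
Proof.
rewrite /pairing (bigD1 i) //= big1 => [|j ji]; rewrite !mxE !eqxx.
  by rewrite mulr1 addr0.
by rewrite (negbTE ji) mulr0 rmorph0 mul0r.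
Qed.

Lemma pairingB theta eta w : pairing (theta - eta) w = pairing theta w - pairing eta w.
Proof.
by rewrite /pairing -sumrB; apply: eq_bigr => i _; rewrite !mxE rmorphB mulrBl.
Qed.

Lemma der_applyE (theta : 'rV[S]_l) (a : 'Hom(V, K^o)) :
  der_apply theta (linear_poly a) = \sum_(i < l) theta 0 i * (form_coef a i)%:MP.
Proof. by apply: eq_bigr => i _; rewrite linear_poly_mderiv. Qed.

Lemma der_apply_delta q i (a : 'Hom(V, K^o)) :
  der_apply (q *: delta_mx 0 i) (linear_poly a) = q * (form_coef a i)%:MP.
Proof.
rewrite der_applyE (bigD1 i) //= big1 => [|j ji]; rewrite !mxE !eqxx.
  by rewrite mulr1 addr0.
by rewrite (negbTE ji) mulr0 mul0r.
Qed.

Lemma der_applyB theta eta (p : S) :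
  der_apply (theta - eta) p = der_apply theta p - der_apply eta p.
Proof. by rewrite /der_apply -sumrB; apply: eq_bigr => i _; rewrite !mxE mulrBl. Qed.

Variables (A : {fset {vspace V}}) (alpha : {vspace V} -> 'Hom(V, K^o)).
Hypotheses (cA : central_arrangement A) (dA : defining_forms A alpha).
Local Notation form H := (linear_poly (alpha H)).
Local Notation Q := (defining_poly alpha A).

Lemma defining_form_neq0 H : H \in A -> alpha H != 0.
Proof.
move=> HA; have dH := cA HA; apply/eqP=> a0; move: dH.
have -> : H = fullv.
  by rewrite -(dA HA) a0; apply/vspaceP=> v; rewrite memv_ker lfunE eqxx memvf.
by rewrite dimvf /dim /= mul1n => /eqP; rewrite -[X in _ == X]addn0 -addn1 eqn_add2l.
Qed.

Lemma form_divides_inj : {in A &, forall H H', divides (form H) (form H') -> H = H'}.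
Proof.
move=> H H' HA H'A /linear_poly_divides_lker; rewrite !dA // => sHH'.
apply/eqP; rewrite eqEdim sHH' /= -ltnS.
by have := cA HA; have := cA H'A; move=> -> ->.
Qed.

Lemma form_prime H : H \in A -> prime_elt (form H).
Proof. by move=> HA; apply/linear_poly_prime/defining_form_neq0. Qed.

Lemma form_not_divides_const H x : H \in A -> x != 0 -> ~ divides (form H) x%:MP.
Proof.
move=> HA x0 [q qE]; have [_ ninv _] := form_prime HA; case: ninv.
by exists ((x^-1)%:MP * q); rewrite -mulrA -qE -mpolyCM mulVf.
Qed.

Lemma form_divides_defining_poly H : H \in A -> divides (form H) Q.
Proof. by move=> HA; apply: (divides_prod HA); apply: dividesxx. Qed.

Lemma defining_poly_neq0 : Q != 0.
Proof.
by rewrite /defining_poly prodf_seq_neq0; apply/allP=> H /form_prime [].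
Qed.

Lemma defining_poly_divides x :
  (forall H, H \in A -> divides (form H) x) -> divides Q x.
Proof.
move=> dx; apply: prime_prod_divides => //.
- by move=> H; apply: form_prime.
- exact: form_divides_inj.
Qed.

Lemma log_der_delta i : log_der alpha A (Q *: delta_mx 0 i).
Proof.
move=> H HA; rewrite der_apply_delta.
exact/dividesMr/form_divides_defining_poly.
Qed.

(** The wedge conditions bound the poles of the values one hyperplane at a time; conversely they are
    recovered by pairing with suitable test derivations. This identifies the logarithmic forms with
    the dual of D(A). *)
Lemma log_form1P (w : 'rV[F]_l) : log_form1 alpha A w <->
  forall theta, log_der alpha A theta -> integral (pairing theta w).
Proof.
have Q0 := defining_poly_neq0.
have tQ0 : tofrac Q != 0 by rewrite tofrac_eq0.
split=> [[[eta wE] wP] theta thetaD | wP].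
  pose s := \sum_(i < l) theta 0 i * eta 0 i.
  have thetaw : pairing theta w = (tofrac Q)^-1 * tofrac s.
    rewrite /pairing rmorph_sum mulr_sumr; apply: eq_bigr => i _ /=.
    by rewrite wE !mxE rmorphM mulrCA.
  suff [p sE] : divides Q s.
    by exists p; rewrite thetaw sE rmorphM mulrC mulfK.
  apply: defining_poly_divides => H HA.
  have [B _ /matrixP BE] := wP H HA.
  have etaE i j : eta 0 i * (form_coef (alpha H) j)%:MP
      - eta 0 j * (form_coef (alpha H) i)%:MP = form H * B i j.
    apply/eqP; rewrite -tofrac_eq rmorphB !rmorphM /=; apply/eqP.
    have := BE i j; rewrite wE !mxE !linear_poly_mderiv -!mulrA -mulrBr.
    by rewrite mulrCA => /(mulfI (invr_neq0 tQ0)).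
  (* Modulo the form, the wedge relation turns [s] times a nonzero coefficient into [eta 0 j] times
     the value of [theta] on the form. *)
  have [j aj] := form_coef_neq0 (defining_form_neq0 HA).
  have sj : divides (form H) (s * (form_coef (alpha H) j)%:MP).
    have -> : s * (form_coef (alpha H) j)%:MP =
        eta 0 j * der_apply theta (form H) + form H * \sum_(i < l) theta 0 i * B i j.
      rewrite der_applyE !mulr_sumr mulr_suml -big_split; apply: eq_bigr => i _ /=.
      rewrite [form H * _]mulrCA -etaE mulrBr !mulrA addrC.
      by rewrite (mulrC (eta 0 j)) subrK.
    apply: dividesD; last exact/dividesMr/dividesxx.
    by apply: dividesMl; apply: thetaD.
  by have [_ _ /(_ _ _ sj) [//|/form_not_divides_const []]] := form_prime HA.
have [eta etaP] : exists eta : 'I_l -> S, forall i, tofrac Q * w 0 i = tofrac (eta i).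
  apply: (exists_choice (fun i (x : S) => tofrac Q * w 0 i = tofrac x)) => i.
  by have := wP _ (log_der_delta i); rewrite pairing_delta.
split=> [|H HA].
  exists (\row_i eta i); apply/rowP=> i.
  by rewrite !mxE -etaP mulKf.
have [q QE] := form_divides_defining_poly HA.
pose c j := (form_coef (alpha H) j)%:MP : S.
have formE j : (dpoly (form H)) 0 j = c j by rewrite mxE linear_poly_mderiv.
have qP H' : H' \in A -> H' != H -> divides (form H') q.
  move=> H'A /eqP nH; have [_ _ H'P] := form_prime H'A.
  have := form_divides_defining_poly H'A; rewrite QE => /H'P [//|].
  by move/(form_divides_inj H'A HA)/nH.
have [b bP] : exists b : 'I_l -> 'I_l -> S, forall i j,
    tofrac q * (tofrac (c j) * w 0 i - tofrac (c i) * w 0 j) = tofrac (b i j).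
  pose P i (y : 'I_l -> S) := forall j,
    tofrac q * (tofrac (c j) * w 0 i - tofrac (c i) * w 0 j) = tofrac (y j).
  apply: (exists_choice P) => i; apply: (exists_choice (fun j (x : S) =>
    tofrac q * (tofrac (c j) * w 0 i - tofrac (c i) * w 0 j) = tofrac x)) => j.
  (* This derivation kills the form of [H], and [q] is divisible by every other form, so it is
     logarithmic; its value on [w] is [q] times a wedge coefficient. *)
  have [] := wP ((q * c j) *: delta_mx 0 i - (q * c i) *: delta_mx 0 j).
    move=> H' H'A; rewrite der_applyB !der_apply_delta.
    have [->|/qP qH'] := eqVneq H' H; last first.
      by apply: dividesB; apply/dividesMr/dividesMr/qH'.
    by rewrite -!mulrA (mulrC (c j)) subrr; apply: divides0.
  by rewrite pairingB !pairing_delta !rmorphM => x xE; exists x; rewrite -xE mulrBr !mulrA.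
have binj x y : tofrac x = tofrac y :> F -> x = y :> S by move/eqP; rewrite tofrac_eq => /eqP.
exists (\matrix_(i, j) b i j).
  split=> [i|i j]; rewrite !mxE; apply: binj; rewrite -?bP ?subrr ?mulr0 ?rmorph0 //.
  by rewrite rmorphN /= -bP -[RHS]mulrN opprB.
apply/matrixP=> i j; rewrite !mxE -bP !linear_poly_mderiv.
have q0 : tofrac q != 0 :> F.
  by rewrite tofrac_eq0; apply: contraNneq Q0 => q0; rewrite QE q0 mul0r.
have f0 : tofrac (form H) != 0 :> F by rewrite tofrac_eq0; case: (form_prime HA).
have -> : tofrac (form H) / tofrac Q = (tofrac q)^-1 :> F.
  by rewrite QE rmorphM /= invfM mulrCA mulfV ?mulr1.
rewrite [RHS](mulKf q0).
by congr (_ - _); rewrite mulrC.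
Qed.

End LogDuality.

(** * Homogeneous bases *)

Section HomogeneousBasis.
Variables (K : fieldType) (l : nat).
Local Notation S := {mpoly K[l]}.

Lemma dhomog0_const (p : S) : p \is 0.-homog -> p = (p@_0%MM)%:MP.
Proof.
move=> hp; apply/mpolyP=> m; rewrite mcoeffC.
have [->|m0] := eqVneq 0%MM m; first by rewrite mulr1.
by rewrite mulr0; apply: dhomog_nemf_coeff hp _; rewrite /= mdeg_eq0 eq_sym.
Qed.

Lemma det_dhomog n (A : 'M[S]_n) (d : 'I_n -> nat) :
  (forall i j, A i j \is (d i).-homog) -> \det A \is (\sum_i d i).-homog.
Proof.
move=> hA; apply: rpred_sum => s _; rewrite -signr_odd; case: odd.
  by rewrite expr1 mulN1r rpredN; apply: dhomog_bigprod.
by rewrite expr0 mul1r; apply: dhomog_bigprod.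
Qed.

Lemma divides_pihomog e d (a p : S) : a \is e.-homog ->
  divides a p -> divides a (pihomog mdeg d p).
Proof.
move=> ha [q ->]; rewrite [q](pihomog_partitionE (leqnn (mmeasure mdeg q))).
rewrite mulr_suml raddf_sum /=; apply: divides_sum => i _.
have hq := dhomogM (pihomogP mdeg i q) ha.
have [<-|ne] := eqVneq (i + e)%N d; first by rewrite pihomog_dE //; exact/dividesMl/dividesxx.
by rewrite (pihomog_ne0 ne hq); apply: divides0.
Qed.

(** Multilinearity in the rows, fully expanded. *)
Lemma det_sum_rows (R : comNzRingType) n N (G : 'I_n -> 'I_N -> 'I_n -> R) :
  \det (\matrix_(i, j) \sum_(k < N) G i k j) =
  \sum_(f : {ffun 'I_n -> 'I_N}) \det (\matrix_(i, j) G i (f i) j).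
Proof.
rewrite /determinant exchange_big /=; apply: eq_bigr => s _.
under eq_bigr => i _ do rewrite mxE.
rewrite bigA_distr_bigA mulr_sumr; apply: eq_bigr => f _.
by congr (_ * _); apply: eq_bigr => i _; rewrite mxE.
Qed.

Definition row_span n (E : 'M[S]_(n, l)) (u : 'rV[S]_l) : Prop :=
  exists c, u = c *m E.

(** As the module contains [Q] times each unit vector, the basis matrix is invertible over the
    fraction field, which forces it to be square. *)
Lemma free_submodule_square (M : 'rV[S]_l -> Prop) (Q : S) :
  Q != 0 -> (forall i, M (Q *: delta_mx 0 i)) ->
  (forall a u, M u -> M (a *: u)) -> free_submodule M ->
  exists E : 'M[S]_l, [/\ \det E != 0, forall i, M (row i E)
    & forall u, M u -> row_span E u].
Proof.
move=> Q0 MQ MZ [n [e [Me Mfree]]].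
pose E : 'M[S]_(n, l) := \matrix_i e i.
have EP (c : 'rV_n) : c *m E = \sum_(i < n) c 0 i *: e i.
  by rewrite mulmx_sum_row; apply: eq_bigr => i _; rewrite rowK.
have Espan u : M u -> row_span E u.
  by case/Mfree=> c [-> _]; exists c; rewrite EP.
have Einj (c c' : 'rV_n) : M (c *m E) -> c *m E = c' *m E -> c = c'.
  move=> Mc cc'; have [c0 [_ c0P]] := Mfree _ Mc.
  by rewrite -(c0P c) ?(c0P c') // -EP.
have [C CP] : exists C : 'I_l -> 'rV[S]_n, forall i, Q *: delta_mx 0 i = C i *m E.
  by apply: (exists_choice (fun i c => Q *: delta_mx 0 i = c *m E)) => i; apply: Espan.
have CE : (\matrix_i C i) *m E = Q%:M.
  by apply/row_matrixP=> i; rewrite row_mul rowK -CP rowE mul_mx_scalar.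
(* Uniqueness of coordinates cancels the last [E] in E C E = Q E, so [C] inverts [E] up to [Q] on
   the other side too. *)
have EC : E *m (\matrix_i C i) = Q%:M.
  have rowQ i : row i (E *m (\matrix_i C i)) *m E = Q *: row i E.
    by rewrite -row_mul -mulmxA CE mul_mx_scalar linearZ.
  apply/row_matrixP=> i; apply: Einj.
    by rewrite rowQ rowK; apply: MZ.
  by rewrite rowQ -row_mul mul_scalar_mx linearZ.
pose toF m1 m2 (A : 'M[S]_(m1, m2)) := map_mx (@tofrac S) A.
have rank_le m1 m2 (A : 'M[S]_(m1, m2)) (B : 'M[S]_(m2, m1)) : A *m B = Q%:M -> (m1 <= m2)%N.
  move=> AB; apply: (@mulmx1_min _ _ _ (toF _ _ A) ((tofrac Q)^-1 *: toF _ _ B)).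
  rewrite -scalemxAr -map_mxM AB map_scalar_mx -mul_scalar_mx -scalar_mxM.
  by rewrite mulVf // tofrac_eq0.
have nl : n = l by apply/eqP; rewrite eqn_leq (rank_le _ _ _ _ EC) (rank_le _ _ _ _ CE).
clear EP Einj EC; subst n; exists E; split=> // [|i]; last by rewrite rowK.
have := congr1 determinant CE; rewrite det_mulmx det_scalar.
by apply: contra_eq_neq => ->; rewrite mulr0 eq_sym expf_neq0.
Qed.

(* The determinant D of a basis E divides the determinant of the matrices made
   of homogeneous components of the rows of E; one of these is nonzero, so D is
   homogeneous, and then one of degree deg D is nonzero, hence a constant
   multiple of D. *)
Lemma homogeneous_basis (M : 'rV[S]_l -> Prop) (Q : S) :
  Q != 0 -> (forall i, M (Q *: delta_mx 0 i)) ->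
  M 0 -> (forall u v, M u -> M v -> M (u + v)) ->
  (forall a u, M u -> M (a *: u)) ->
  (forall d u, M u -> M (map_mx (pihomog mdeg d) u)) ->
  free_submodule M ->
  exists (k : 'I_l -> nat) (E : 'M[S]_l), [/\ forall i j, E i j \is (k i).-homog,
    \det E != 0 & forall u, M u <-> row_span E u].
Proof.
move=> Q0 MQ M0 MD MZ Mhom Mfree.
have [E [E0 ME Espan]] := free_submodule_square Q0 MQ MZ Mfree.
(* For a nonzero entry [mmeasure] is the degree plus one, so all components have degree below
   [N]. *)
pose N := (\max_i \max_j mmeasure mdeg (E i j))%N.
pose Ef (f : {ffun 'I_l -> 'I_N}) := \matrix_(i, j) pihomog mdeg (f i) (E i j).
have MEf f i : M (row i (Ef f)).
  suff -> : row i (Ef f) = map_mx (pihomog mdeg (f i)) (row i E) by apply: Mhom.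
  by apply/rowP=> j; rewrite !mxE.
have detE : \det E = \sum_f \det (Ef f).
  rewrite -(det_sum_rows (fun i k j => pihomog mdeg k (E i j))).
  congr (\det _); apply/matrixP=> i j; rewrite mxE.
  apply: pihomog_partitionE; rewrite /N.
  by apply: leq_trans (leq_bigmax i); apply: (leq_bigmax j).
have EfE f : exists X, Ef f = X *m E.
  have [X XP] := exists_choice (fun i c => row i (Ef f) = c *m E) (fun i => Espan _ (MEf f i)).
  by exists (\matrix_i X i); apply/row_matrixP=> i; rewrite row_mul rowK XP.
have hEf f : \det (Ef f) \is (\sum_i f i).-homog.
  by apply: det_dhomog => i j; rewrite mxE; apply: pihomogP.
have [f f0] : exists f, \det (Ef f) != 0.
  apply: NNPP => none; case/negP: E0; rewrite detE big1 // => f _.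
  by apply/eqP; apply: contra_notT none => f0; exists f.
have [d hd] : exists d, \det E \is d.-homog.
  have [X XE] := EfE f; rewrite XE det_mulmx in f0.
  have := hEf f; rewrite XE det_mulmx => /(dhomog_factor f0) [e [_ _ hE]].
  by exists (\sum_i f i - e)%N.
have [g [g0 gd]] : exists g, \det (Ef g) != 0 /\ (\sum_i g i)%N = d.
  apply: NNPP => none; case/negP: E0; rewrite -(pihomog_dE hd) detE raddf_sum big1 // => g _ /=.
  have [g0|g0] := eqVneq (\det (Ef g)) 0; first by rewrite g0 raddf0.
  have gd : (\sum_i g i)%N != d by apply/eqP=> gd; apply: none; exists g.
  exact: pihomog_ne0 gd (hEf g).
have [X XE] := EfE g.
have [x x0 xE] : exists2 x : K, x != 0 & \det X = x%:MP.
  have X0 : \det X * \det E != 0 by rewrite -det_mulmx -XE.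
  have := hEf g; rewrite XE det_mulmx gd => /(dhomog_factor X0) [e [ed hX hE]].
  have := dhomog_uniq E0 hd hE => /eqP; rewrite -[X in X == _](subnK ed) -{2}[(d - e)%N]addn0.
  rewrite eqn_add2l => /eqP e0; rewrite e0 in hX.
  exists (\det X)@_0%MM; last exact: dhomog0_const.
  apply: contraNneq X0 => x0.
  by rewrite (dhomog0_const hX) x0 mpolyC0 mul0r.
(* With a nonzero constant determinant the transition matrix is invertible over [S], so the
   homogeneous rows span what [E] spans. *)
have uX : X \in unitmx.
  by rewrite unitmxE xE rmorph_unit // unitfE.
exists (fun i => g i), (Ef g); split=> // [i j|u]; first by rewrite mxE; apply: pihomogP.
split=> [/Espan [c ->]|[c ->]].
  by exists (c *m invmx X); rewrite XE mulmxA mulmxKV.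
rewrite mulmx_sum_row; by elim/big_ind: _ => // i _; apply/MZ/MEf.
Qed.

End HomogeneousBasis.

(** * Deletion of a hyperplane *)

Section LogDer.
Variables (K : fieldType) (l : nat).
Local Notation S := {mpoly K[l]}.
Local Notation V := 'rV[K]_l.
Variables (A : {fset {vspace V}}) (alpha : {vspace V} -> 'Hom(V, K^o)).
Implicit Types (theta eta : 'rV[S]_l) (a : 'Hom(V, K^o)).
Local Notation form H := (linear_poly (alpha H)).

Lemma der_applyZ q theta (p : S) : der_apply (q *: theta) p = q * der_apply theta p.
Proof. by rewrite /der_apply mulr_sumr; apply: eq_bigr => i _; rewrite !mxE mulrA. Qed.

Lemma der_applyD theta eta (p : S) :
  der_apply (theta + eta) p = der_apply theta p + der_apply eta p.
Proof. by rewrite /der_apply -big_split; apply: eq_bigr => i _; rewrite !mxE mulrDl. Qed.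

Lemma der_apply_row n (c : 'rV[S]_n) (E : 'M[S]_(n, l)) (p : S) :
  der_apply (c *m E) p = \sum_i c 0 i * der_apply (row i E) p.
Proof.
rewrite mulmx_sum_row; elim/big_rec2: _ => [|i x y _ <-].
  by rewrite /der_apply big1 // => i _; rewrite mxE mul0r.
by rewrite der_applyD der_applyZ.
Qed.

Lemma log_der0 : log_der alpha A 0.
Proof.
move=> H HA; exists 0; rewrite mul0r /der_apply big1 // => i _.
by rewrite mxE mul0r.
Qed.

Lemma log_derD theta eta :
  log_der alpha A theta -> log_der alpha A eta -> log_der alpha A (theta + eta).
Proof. by move=> Dt De H HA; rewrite der_applyD; apply: dividesD; [apply: Dt|apply: De]. Qed.

Lemma log_derZ q theta : log_der alpha A theta -> log_der alpha A (q *: theta).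
Proof. by move=> Dt H HA; rewrite der_applyZ; apply/dividesMl/Dt. Qed.

(** The derivatives of a linear form are constants, so evaluation on it commutes with taking
    homogeneous components. *)
Lemma log_der_pihomog d theta :
  log_der alpha A theta -> log_der alpha A (map_mx (pihomog mdeg d) theta).
Proof.
move=> Dt H HA.
suff -> : der_apply (map_mx (pihomog mdeg d) theta) (form H)
    = pihomog mdeg d (der_apply theta (form H)).
  exact/(divides_pihomog _ (linear_poly_homog _))/Dt.
rewrite !der_applyE raddf_sum /=; apply: eq_bigr => i _.
by rewrite mxE mulrC mul_mpolyC [in RHS]mulrC mul_mpolyC linearZ.
Qed.

Lemma der_apply_homog d theta a : (forall j, theta 0 j \is d.-homog) ->
  der_apply theta (linear_poly a) \is d.-homog.
Proof.
move=> ht; rewrite der_applyE; apply: dhomog_sum => i _.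
by rewrite mulrC mul_mpolyC; apply/dhomogZ/ht.
Qed.

Lemma poly_deg0 k : poly_deg k (0 : S).
Proof. by case: k => // n; apply: dhomog0. Qed.

Lemma poly_degM k m (p q : S) : poly_deg k p -> poly_deg m q -> poly_deg (k + m) (p * q).
Proof.
case: k => [k|k] /= hp; last by rewrite hp mul0r => _; apply: poly_deg0.
case: m => [m|m] /= hq; last by rewrite hq mulr0; apply: poly_deg0.
exact: dhomogM.
Qed.

(** [e] is the degree of [c], common to all the products. The difference [k i - e] may be negative
    where [h i] vanishes, hence [poly_deg]. *)
Lemma mul_dhomog_degree (c : S) n (h : 'I_n -> S) (k : 'I_n -> nat) :
  c != 0 -> (exists i, h i != 0) -> (forall i, c * h i \is (k i).-homog) ->
  exists e : int, forall i, poly_deg ((k i)%:Z - e) (h i).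
Proof.
move=> c0 [i0 hi0] hch.
have [e0 [_ hc _]] := dhomog_factor (mulf_neq0 c0 hi0) (hch i0).
exists e0%:Z => i; have [->|hi] := eqVneq (h i) 0; first exact: poly_deg0.
have [e [ek hc' hh]] := dhomog_factor (mulf_neq0 c0 hi) (hch i).
by rewrite (dhomog_uniq c0 hc hc') subzn.
Qed.

End LogDer.

Section Deletion.
Variables (K : fieldType) (l : nat).
Local Notation S := {mpoly K[l]}.
Local Notation V := 'rV[K]_l.
Variables (A : {fset {vspace V}}) (alpha : {vspace V} -> 'Hom(V, K^o)).
Local Notation form H := (linear_poly (alpha H)).
Hypotheses (cA : central_arrangement A) (dA : defining_forms A alpha).
Variable H : {vspace V}.
Hypothesis HA : H \in A.
Local Notation A' := (A `\ H)%fset.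

Lemma central_arrangementD1 : central_arrangement A'.
Proof. by move=> H'; rewrite in_fsetD1 => /andP [_]; apply: cA. Qed.

Lemma defining_formsD1 : defining_forms A' alpha.
Proof. by move=> H'; rewrite in_fsetD1 => /andP [_]; apply: dA. Qed.

Lemma log_derD1 theta : log_der alpha A theta <->
  log_der alpha A' theta /\ divides (form H) (der_apply theta (form H)).
Proof.
split=> [Dt|[Dt DH] H' H'A].
  split; last exact: Dt.
  by move=> H'; rewrite in_fsetD1 => /andP [_]; apply: Dt.
have [->|H'H] := eqVneq H' H; first exact: DH.
by apply: Dt; rewrite in_fsetD1 H'H.
Qed.

Lemma form_not_divides_deletion : ~ divides (form H) (defining_poly alpha A').
Proof.
case/(prime_divides_prod (form_prime cA dA HA)) => H'; rewrite in_fsetD1.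
by case/andP=> /eqP H'H H'A /(form_divides_inj cA dA HA H'A) /esym.
Qed.

(* D(A) is the kernel of D(A') -> S/alpha_H, theta |-> theta(alpha_H).  The
   image of a basis is c h with c a gcd, computed in the polynomial ring
   S/alpha_H, so that D(A) is cut out by the coprime vector h. *)
Lemma log_der_deletion : free_arrangement alpha A' ->
  exists (k : 'I_l -> nat) (E : 'M[S]_l) (h : 'rV[S]_l) (e : int),
    [/\ forall i j, E i j \is (k i).-homog,
        \det E != 0,
        forall u, log_der alpha A u <->
          exists c : 'rV[S]_l, u = c *m E /\ divides (form H) (\sum_i c 0 i * h 0 i)
      & [/\ exists i, ~ divides (form H) (h 0 i),
        forall i, poly_deg ((k i)%:Z - e) (h 0 i)
      & forall p : 'I_l -> S,
          (forall i j, divides (form H) (h 0 j * p i - h 0 i * p j)) ->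
          exists t, forall i, divides (form H) (p i - t * h 0 i)]].
Proof.
move=> freeA'; have cA' := central_arrangementD1; have dA' := defining_formsD1.
have Q0 := defining_poly_neq0 cA' dA'; set Q := defining_poly alpha A' in Q0.
have DQ := log_der_delta alpha (A := A').
have [k [E [hE E0 spanE]]] := homogeneous_basis Q0 DQ (@log_der0 _ _ A' alpha)
  (@log_derD _ _ A' alpha) (@log_derZ _ _ A' alpha) (@log_der_pihomog _ _ A' alpha) freeA'.
have aH0 := defining_form_neq0 cA dA HA.
have [pi [pi0 piP pi_homog]] := hyperplane_retraction aH0.
have divP := retraction_divides pi0 piP.
pose g i := der_apply (row i E) (form H).
have hg i : g i \is (k i).-homog by apply: der_apply_homog => j; rewrite mxE.
(* Otherwise the form would divide the value on it of every element of D(A'), in particular a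
   nonzero constant times [Q]. *)
have [i0 gi0] : exists i, pi (g i) != 0.
  apply: NNPP => none; have [j aj] := form_coef_neq0 aH0.
  have [c cE] := proj1 (spanE _) (DQ j).
  have : divides (form H) (Q * (form_coef (alpha H) j)%:MP).
    rewrite -der_apply_delta cE der_apply_row; apply: divides_sum => i _.
    apply/dividesMl/divP/eqP; apply: contra_notT none => gi.
    by exists i.
  have [_ _ pH] := form_prime cA dA HA.
  by case/pH; [apply: form_not_divides_deletion | exact: (form_not_divides_const cA dA HA aj)].
(* The gcd is computed in [S] for the images under [pi]; applying [pi] to [c] and [h0] brings the
   factorisation back into the image of [pi]. *)
have [c [h0 [c0 gE h0P]]] := @primitive_vector _ l (fun i => pi (g i)) (@mpoly_factorial l K)
  (ex_intro _ i0 gi0).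
pose h i := pi (h0 i).
have gh i : pi (g i) = pi c * h i by rewrite -rmorphM -gE (retraction_id pi0 piP).
have pic0 : pi c != 0 by apply: contraNneq gi0; rewrite gh => ->; rewrite mul0r.
have hi0 : h i0 != 0 by apply: contraNneq gi0; rewrite gh => ->; rewrite mulr0.
have pih i : pi (h i) = h i by apply: (retraction_id pi0 piP).
have hgh i : pi c * h i \is (k i).-homog by rewrite -gh; apply/pi_homog/hg.
have [e he] := mul_dhomog_degree pic0 (ex_intro _ i0 hi0) hgh.
exists k, E, (\row_i h i), e; split=> //.
  move=> u; rewrite log_derD1; split=> [[/spanE [b ->]] | [b [-> bh]]].
    rewrite der_apply_row => /divP bg; exists b; split=> //; apply/divP.
    apply: (mulfI pic0); rewrite mulr0 -[RHS]bg !rmorph_sum /= mulr_sumr.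
    by apply: eq_bigr => i _; rewrite /= mxE !rmorphM pih mulrCA -gh.
  split; first by apply/spanE; exists b.
  move/divP: bh => bh; apply/divP; rewrite der_apply_row -[RHS](mulr0 (pi c)) -[X in _ = _ * X]bh.
  rewrite !rmorph_sum /= mulr_sumr.
  by apply: eq_bigr => i _; rewrite /= mxE !rmorphM pih mulrCA -gh.
split=> [|i|p hp].
- by exists i0; rewrite mxE => /divP; rewrite pih; apply/eqP.
- by rewrite mxE.
have [t tE] : exists t, forall i, pi (p i) = t * h0 i.
  (* Primitivity concerns [h0], the hypothesis on [p] concerns [h]; they are linked by
     [c * h0 i = pi (g i) = pi c * h i]. *)
  apply: h0P => i j; apply: (mulfI c0); rewrite !mulrA -!gE !gh -!mulrA.
  congr (_ * _); apply/eqP; rewrite -subr_eq0; apply/eqP.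
  have /divP := hp i j; rewrite !mxE rmorphB !rmorphM !pih.
  by [].
exists (pi t) => i; apply/divP.
rewrite mxE rmorphB rmorphM pih (retraction_id pi0 piP) -rmorphM -tE.
by rewrite (retraction_id pi0 piP) subrr.
Qed.

End Deletion.

(** * Freeness when a coordinate of the congruence is a unit *)

Lemma mulmx_det_inj (R : idomainType) m n (E : 'M[R]_n) :
  \det E != 0 -> injective (fun c : 'M[R]_(m, n) => c *m E).
Proof.
move=> E0 c c' /(congr1 (fun u => u *m \adj E)).
rewrite /= -!mulmxA mul_mx_adj !mul_mx_scalar => /matrixP cc'.
by apply/matrixP=> i j; apply: (mulfI E0); have := cc' i j; rewrite !mxE.
Qed.

(* If some h_i is a unit, the coordinates c_j with j <> i are free and the
   condition that a divide c.h is solved for c_i. *)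
Lemma free_congruence_submodule (R : idomainType) (n : nat) (E : 'M[R]_n)
    (M : 'rV[R]_n -> Prop) (a : R) (h : 'rV[R]_n) i :
  a != 0 -> \det E != 0 -> invertible (h 0 i) ->
  (forall u, M u <-> exists c : 'rV[R]_n,
     u = c *m E /\ divides a (\sum_j c 0 j * h 0 j)) ->
  free_submodule M.
Proof.
move=> a0 E0 [x xh] ME.
(* [X] replaces the coordinate [c_i] by a c_i - x sum_{j != i} c_j h_j and keeps the others; the
   rows of [X *m E] will be the basis. *)
pose v j := if j == i then a else - (x * h 0 j).
pose X : 'M[R]_n := \matrix_(j, k) if k == i then v j else (j == k)%:R.
have XE (c : 'rV_n) k : (c *m X) 0 k = if k == i then \sum_j c 0 j * v j else c 0 k.
  rewrite mxE; case: ifP => ki; first by apply: eq_bigr => j _; rewrite mxE ki.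
  rewrite (bigD1 k) //= big1 => [|j jk]; rewrite mxE ki ?eqxx ?mulr1 ?addr0 //.
  by rewrite (negbTE jk) mulr0.
have vE (c : 'rV_n) : \sum_j c 0 j * v j = c 0 i * a - \sum_(j | j != i) x * (c 0 j * h 0 j).
  rewrite (bigD1 i) //= /v eqxx -sumrN; congr (_ + _); apply: eq_bigr => j /negbTE ->.
  by rewrite mulrN mulrCA.
have MX c : M (c *m X *m E).
  apply/ME; exists (c *m X); split=> //.
  rewrite (bigD1 i) //= XE eqxx vE mulrBl -mulr_sumr [X in _ - X + _]mulrAC xh mul1r.
  under [\sum_(_ | _) (c *m X) 0 _ * _]eq_bigr => j ji do rewrite XE (negbTE ji).
  rewrite subrK; apply/dividesMr/dividesMl/dividesxx.
have injX : injective (fun c : 'rV_n => c *m X).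
  move=> c c' /rowP cc'; apply/rowP=> k.
  have off j : j != i -> c 0 j = c' 0 j.
    by move=> ji; have := cc' j; rewrite !XE (negbTE ji).
  have [->|/off //] := eqVneq k i; apply: (mulIf a0).
  have := cc' i; rewrite !XE eqxx !vE (eq_bigr (fun j => x * (c' 0 j * h 0 j))).
    by move/addIr.
  by move=> j /off ->.
exists n, (fun j => row j (X *m E)); split=> [j|u].
  by rewrite row_mul rowE; apply: MX.
case/ME=> b [-> [q bq]].
(* Solving for the coordinate [i] of the preimage gives [x * q], where [q] is the quotient of the
   congruence by [a]. *)
pose c : 'rV[R]_n := \row_j if j == i then x * q else b 0 j.
have cX : c *m X = b.
  apply/rowP=> k; rewrite XE; case: eqP => [->|/eqP ki]; last by rewrite mxE (negbTE ki).
  rewrite vE mxE eqxx -mulrA -bq (bigD1 i) //= mulrDr mulrCA xh mulr1 mulr_sumr.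
  under [X in _ - X]eq_bigr => j ji do rewrite mxE (negbTE ji).
  by rewrite addrK.
exists c; split=> [|c' /eqP].
  by rewrite -mulmx_sum_row mulmxA cX.
rewrite -mulmx_sum_row mulmxA => /eqP /(mulmx_det_inj E0).
by rewrite -cX => /injX.
Qed.

(** * Degrees of rational functions *)

Section RationalDegree.
Variables (K : fieldType) (l : nat).
Local Notation S := {mpoly K[l]}.
Local Notation F := {fraction {mpoly K[l]}}.
Implicit Types x y : F.

Lemma rat_degM k m x y : rat_deg k x -> rat_deg m y -> rat_deg (k + m) (x * y).
Proof.
case=> p [q [a [b [hp hq q0 -> ->]]]] [p' [q' [a' [b' [hp' hq' q'0 -> ->]]]]].
exists (p * p'), (q * q'), (a + a')%N, (b + b')%N; split.
- exact: dhomogM.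
- exact: dhomogM.
- exact: mulf_neq0.
- by rewrite !PoszD opprD addrACA.
by rewrite !rmorphM /= invfM mulrACA.
Qed.

Lemma rat_degD k x y : rat_deg k x -> rat_deg k y -> rat_deg k (x + y).
Proof.
case=> p [q [a [b [hp hq q0 -> ->]]]] [p' [q' [a' [b' [hp' hq' q'0 kE ->]]]]].
have ab : (a + b' = a' + b)%N.
  by apply/eqP; rewrite -eqz_nat !PoszD -(subrK b%:Z a%:Z) kE addrAC subrK.
exists (p * q' + p' * q), (q * q'), (a + b')%N, (b + b')%N; split.
- by apply: rpredD; [|rewrite ab]; apply: dhomogM.
- exact: dhomogM.
- exact: mulf_neq0.
- by rewrite !PoszD opprD addrACA subrr addr0.
rewrite rmorphD !rmorphM /= mulrDl !invfM.
have t0 (r : S) : r != 0 -> tofrac r != 0 :> F by rewrite tofrac_eq0.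
congr (_ + _); first by rewrite [RHS]mulrACA mulfV ?mulr1 // t0.
by rewrite [RHS]mulrA mulfK // t0.
Qed.

Lemma rat_degN k x : rat_deg k x -> rat_deg k (- x).
Proof.
case=> p [q [a [b [hp hq q0 -> ->]]]]; exists (- p), q, a, b; split=> //.
  by rewrite rpredN.
by rewrite rmorphN mulNr.
Qed.

(* A variable is needed to write 0 as 0 / x_i^n in negative degree. *)
Lemma rat_deg_poly (i : 'I_l) k (p : S) : poly_deg k p -> rat_deg k (tofrac p).
Proof.
case: k => [k|k] /= hp.
  exists p, 1, k, 0%N; split=> //; first exact: dhomog1.
  - exact: oner_neq0.
  - by rewrite subr0.
  by rewrite rmorph1 divr1.
exists 0, ('X_i ^+ k.+1), 0%N, k.+1; split.
- exact: dhomog0.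
- by rewrite -[X in X.-homog]mul1n; apply: dhomogMn; rewrite dhomogX /= mdeg1.
- by apply: expf_neq0; rewrite -msize_poly_eq0 msizeX mdeg1.
- by rewrite sub0r NegzE.
by rewrite hp rmorph0 mul0r.
Qed.

Lemma rat_deg0 (i : 'I_l) k : rat_deg k (0 : F).
Proof. by rewrite -(rmorph0 (@tofrac S)); apply/(rat_deg_poly i)/poly_deg0. Qed.

Lemma basis_unit (E : 'M[S]_l) : \det E != 0 ->
  (map_mx (@tofrac S) E)^T \in unitmx.
Proof. by move=> E0; rewrite unitmx_tr unitmxE det_map_mx unitfE tofrac_eq0. Qed.

(** Row [i] of this inverse is the dual form omega_i. By Cramer's rule its entries are cofactors
    over the determinant, and the deleted row [i] accounts for the degree. *)
Lemma rat_deg_invmx (E : 'M[S]_l) (k : 'I_l -> nat) i j :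
  \det E != 0 -> (forall i j, E i j \is (k i).-homog) ->
  rat_deg (- (k i)%:Z) (invmx (map_mx (@tofrac S) E)^T i j).
Proof.
move=> E0 hE; have hdet := det_dhomog hE.
have kE : (\sum_i k i = k i + \sum_m k (lift i m))%N by rewrite (bigD1_ord i).
exists (cofactor E i j), (\det E), (\sum_m k (lift i m))%N, (\sum_i k i)%N; split=> //.
- rewrite /cofactor -signr_odd; case: odd.
    rewrite expr1 mulN1r rpredN; apply: det_dhomog => m m'; rewrite !mxE; exact: hE.
  by rewrite expr0 mul1r; apply: det_dhomog => m m'; rewrite !mxE; exact: hE.
- by rewrite kE PoszD opprD addrCA subrr addr0.
rewrite /invmx (basis_unit E0) det_tr det_map_mx -trmx_adj -map_mx_adj !mxE.
by rewrite mulrC.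
Qed.

End RationalDegree.

(** * Generators of the logarithmic forms *)

Section Presentation.
Variables (K : fieldType) (l : nat).
Local Notation S := {mpoly K[l]}.
Local Notation F := {fraction {mpoly K[l]}}.
Variables (E : 'M[S]_l) (h : 'rV[S]_l) (a : S).

(** The coordinates in the dual basis, that is, the values on the rows of [E]. *)
Definition presentation_row (v : 'rV[S]_(l + 1)) : 'rV[F]_l :=
  \row_i (tofrac (v 0 (lshift 1 i)) - tofrac (v 0 (rshift l 0) * h 0 i) / tofrac a).

(* The forms omega_i dual to the rows of E, and -(sum_i h_i omega_i) / a. *)
Definition presentation (v : 'rV[S]_(l + 1)) : rat_form1 K l :=
  presentation_row v *m invmx (map_mx (@tofrac S) E)^T.

Fact presentation_is_linear : linear presentation.
Proof.
move=> q u v; rewrite /presentation.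
have -> : presentation_row (q *: u + v) = tofrac q *: presentation_row u + presentation_row v.
  apply/rowP=> i; rewrite !mxE !(rmorphD, rmorphM) /= !mulrDl opprD addrACA mulrBr.
  by rewrite !mulrA.
by rewrite mulmxDl -scalemxAl.
Qed.

HB.instance Definition _ := GRing.isLinear.Build S 'rV[S]_(l + 1) (rat_form1 K l)
  _ presentation presentation_is_linear.

Hypothesis E0 : \det E != 0.

Lemma pairing_row (c : 'rV[S]_l) (w : 'rV[F]_l) :
  pairing (c *m E) w = \sum_i tofrac (c 0 i) * (w *m (map_mx (@tofrac S) E)^T) 0 i.
Proof.
rewrite /pairing; under eq_bigr => j _ do rewrite mxE rmorph_sum mulr_suml.
rewrite exchange_big; apply: eq_bigr => i _; rewrite mxE mulr_sumr.
by apply: eq_bigr => j _; rewrite !mxE rmorphM /= -mulrA (mulrC (w 0 j)).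
Qed.

Lemma pairing_presentation c v : pairing (c *m E) (presentation v) =
  \sum_i tofrac (c 0 i) * presentation_row v 0 i.
Proof. by rewrite pairing_row mulmxKV // basis_unit. Qed.

End Presentation.

(** A nonzero constant term forces degree 0; a nonminimal presentation therefore has a unit among
    its coefficients. *)
Lemma poly_deg_const (K : fieldType) l k (p : {mpoly K[l]}) :
  poly_deg k p -> p@_0%MM != 0 -> p = (p@_0%MM)%:MP.
Proof.
case: k => [k|k] /= hp p0; last by rewrite hp mcoeff0 eqxx in p0.
suff k0 : k = 0%N by rewrite k0 in hp; apply: dhomog0_const.
apply/eqP; apply: contraNT p0 => k0.
by rewrite (dhomog_nemf_coeff hp) //= mdeg0 eq_sym.
Qed.

(** * The resolution of the logarithmic forms *)

Section DualSPOG.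
Variables (K : fieldType) (l : nat).
Local Notation S := {mpoly K[l]}.
Local Notation F := {fraction {mpoly K[l]}}.
Local Notation V := 'rV[K]_l.
Variables (A : {fset {vspace V}}) (alpha : {vspace V} -> 'Hom(V, K^o)).
Hypotheses (cA : central_arrangement A) (dA : defining_forms A alpha).
Variable H : {vspace V}.
Hypothesis HA : H \in A.
Local Notation a := (linear_poly (alpha H)).

Variables (k : 'I_l -> nat) (E : 'M[S]_l) (h : 'rV[S]_l) (e : int).
Hypotheses (hE : forall i j, E i j \is (k i).-homog) (E0 : \det E != 0)
  (DE : forall u, log_der alpha A u <->
     exists c : 'rV[S]_l, u = c *m E /\ divides a (\sum_i c 0 i * h 0 i))
  (h_ndiv : exists i, ~ divides a (h 0 i))
  (h_deg : forall i, poly_deg ((k i)%:Z - e) (h 0 i))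
  (h_prim : forall p : 'I_l -> S,
     (forall i j, divides a (h 0 j * p i - h 0 i * p j)) ->
     exists t, forall i, divides a (p i - t * h 0 i)).

Local Notation phi := (presentation E h a).
Local Notation B := (row_mx h (const_mx a : 'rV[S]_1)).

Let a0 : a != 0. Proof. by case: (form_prime cA dA HA). Qed.
Let ta0 : tofrac a != 0 :> F. Proof. by rewrite tofrac_eq0. Qed.

Let tofrac_inj (x y : S) : tofrac x = tofrac y :> F -> x = y.
Proof. by move/eqP; rewrite tofrac_eq => /eqP. Qed.

Let relation_left (u : 'rV[S]_1) i : (u *m B) 0 (lshift 1 i) = u 0 0 * h 0 i.
Proof. by rewrite mul_mx_row row_mxEl mxE big_ord1. Qed.

Let relation_right (u : 'rV[S]_1) : (u *m B) 0 (rshift l 0) = u 0 0 * a.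
Proof. by rewrite mul_mx_row row_mxEr mxE big_ord1 mxE. Qed.

Let row_eq (u v : 'rV[S]_(l + 1)) : (forall i, u 0 (lshift 1 i) = v 0 (lshift 1 i)) ->
  u 0 (rshift l 0) = v 0 (rshift l 0) -> u = v.
Proof.
move=> uvl uvr; apply/rowP=> i; rewrite -[i]splitK.
by case: split => j /=; [apply: uvl | rewrite [j]ord1; apply: uvr].
Qed.

Lemma log_form1_presentation w :
  log_form1 alpha A w <-> exists v, w = phi v.
Proof.
rewrite (log_form1P cA dA); split=> [wP|[v ->] u /DE [c [-> [q qE]]]]; last first.
  rewrite pairing_presentation //.
  exists (\sum_i c 0 i * v 0 (lshift 1 i) - v 0 (rshift l 0) * q).
  rewrite rmorphB rmorph_sum /=.
  under eq_bigr => i _ do rewrite mxE mulrBr -rmorphM.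
  rewrite sumrB; congr (_ - _).
  under eq_bigr => i _ do rewrite mulrA -rmorphM mulrCA.
  by rewrite -mulr_suml -rmorph_sum -mulr_sumr qE mulrA rmorphM mulfK.
have [x xE] : exists x, w *m (map_mx (@tofrac S) E)^T = x by eexists.
have xP (c : 'rV[S]_l) : divides a (\sum_i c 0 i * h 0 i) ->
    integral (\sum_i tofrac (c 0 i) * x 0 i).
  by move=> ca; rewrite -xE -pairing_row; apply/wP/DE; exists c.
(* [a] times row [i] of [E] lies in D(A), so [a] clears the denominators of the coordinates [x]. *)
have [p pE] : exists p : 'I_l -> S, forall i, tofrac a * x 0 i = tofrac (p i).
  apply: (exists_choice (fun i (p : S) => tofrac a * x 0 i = tofrac p)) => i.
  have [|y] := xP (a *: delta_mx 0 i).
    apply: divides_sum => j _; rewrite mxE.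
    exact/dividesMr/dividesMr/dividesxx.
  rewrite (bigD1 i) //= big1 => [|j ji]; rewrite !mxE !eqxx.
    by rewrite mulr1 addr0 => yE; exists y.
  by rewrite (negbTE ji) mulr0 rmorph0 mul0r.
have [i j|t tE] := h_prim (p := p).
  (* The coefficient vector h_j e_i - h_i e_j is orthogonal to [h]; pairing with the derivation it
     defines makes [p] parallel to [h] modulo [a]. *)
  have [|y] := xP (h 0 j *: delta_mx 0 i - h 0 i *: delta_mx 0 j).
    rewrite (_ : \sum_m _ = 0); first exact: divides0.
    under eq_bigr => m _ do rewrite !mxE eqxx mulrBl.
    rewrite sumrB (bigD1 i) //= big1 => [|m /negbTE mi]; last by rewrite mi mulr0 mul0r.
    rewrite (bigD1 j) //= big1 => [|m /negbTE mj]; last by rewrite mj mulr0 mul0r.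
    by rewrite !eqxx !mulr1 !addr0 mulrC subrr.
  under eq_bigr => m _ do rewrite !mxE eqxx rmorphB mulrBl.
  rewrite sumrB (bigD1 i) //= big1 => [|m /negbTE mi]; last by rewrite mi mulr0 rmorph0 mul0r.
  rewrite (bigD1 j) //= big1 => [|m /negbTE mj]; last by rewrite mj mulr0 rmorph0 mul0r.
  rewrite !eqxx !mulr1 !addr0 => yE; exists y; apply: tofrac_inj.
  by rewrite rmorphB !rmorphM /= -!pE -yE mulrBl ![_ * tofrac a]mulrC !(mulrCA (tofrac a)).
have [q qE] : exists q : 'I_l -> S, forall i, p i - t * h 0 i = q i * a.
  exact: (exists_choice (fun i q => p i - t * h 0 i = q * a)).
(* The coordinates are q_i + t h_i / a, and the last generator carries a minus sign, hence [- t]. *)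
exists (row_mx (\row_i q i) (const_mx (- t))).
apply: (can_inj (mulmxK (basis_unit E0))); rewrite mulmxKV ?basis_unit //.
apply/rowP=> i; rewrite xE [RHS]mxE row_mxEl row_mxEr !mxE.
apply: (mulfI ta0); rewrite pE mulrBr mulrCA mulfV // mulr1 -!rmorphM -rmorphB.
by congr tofrac; rewrite mulNr opprK mulrC -qE subrK.
Qed.

(** omega_r has degree -k_r and the last generator has degree -(e + 1), whence these shifts. *)
Let presentation_deg (m : int) (v : 'rV[S]_(l + 1)) :
  shifted_deg (row_mx (\row_i (k i)%:Z) (const_mx (e + 1) : 'rV[int]_1)) m v ->
  rat_form1_deg m (phi v).
Proof.
move=> hv j; have [i _] := h_ndiv; rewrite mxE.
elim/big_ind: _ => [||r _]; [exact: rat_deg0 | exact: rat_degD |].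
have -> : m = (k r)%:Z + m + - (k r)%:Z by rewrite addrAC subrr add0r.
apply: rat_degM; last exact: rat_deg_invmx.
rewrite mxE; apply: rat_degD.
  by apply: (rat_deg_poly i); have := hv (lshift 1 r); rewrite row_mxEl mxE.
apply: rat_degN.
(* The last component of [v], [h 0 r] and the division by [a] contribute the three summands. *)
have -> : (k r)%:Z + m = (e + 1 + m + ((k r)%:Z - e)) + -1.
  by rewrite [e + 1 + m]addrAC [_ + 1 + _]addrAC addrK [RHS]addrC -addrA addKr.
apply: rat_degM.
  apply: (rat_deg_poly i); apply: poly_degM (h_deg r).
  by have := hv (rshift l 0); rewrite row_mxEr mxE.
exists 1, a, 0%N, 1%N; split=> //; first exact: dhomog1.
  exact: linear_poly_homog.
by rewrite rmorph1 mul1r.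
Qed.

Lemma dual_SPOG_presentation :
  (forall i, (h 0 i)@_0%MM = 0) -> dual_SPOG alpha A.
Proof.
move=> h00; exists (e + 1), (\row_i (k i)%:Z), h, (alpha H), phi.
split; first exact: (defining_form_neq0 cA dA HA).
split.
- split=> [m v hv|]; last exact: presentation_deg.
  have := hv 0; rewrite mxE addrK => hv0 i; rewrite -[i]splitK.
  case: split => j /=.
    rewrite relation_left row_mxEl mxE.
    have -> : (k j)%:Z + m = e + m + ((k j)%:Z - e) by rewrite [RHS]addrC -addrA addKr.
    exact: poly_degM (h_deg j).
  rewrite [j]ord1 relation_right row_mxEr mxE addrAC; apply: poly_degM => //.
  exact: linear_poly_homog.
- move=> u v /rowP /(_ (rshift l 0)); rewrite !relation_right => /(mulIf a0) uv.
  by apply/rowP=> i; rewrite [i]ord1.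
- move=> v; split=> [v0|[u ->]].
    have {}v0 i : v 0 (lshift 1 i) * a = v 0 (rshift l 0) * h 0 i.
      have : presentation_row h a v = 0.
        by apply: (can_inj (mulmxKV (basis_unit E0))); rewrite mul0mx.
      move/rowP/(_ i); rewrite !mxE => /eqP; rewrite subr_eq0 => /eqP vE.
      by apply: tofrac_inj; rewrite !rmorphM /= vE rmorphM mulfVK.
    (* Choosing [i] with [h 0 i] not divisible by the prime [a] puts [a] in the last component; the
       quotient [u] is the coefficient of the relation. *)
    have [i hi] := h_ndiv; have [_ _ ap] := form_prime cA dA HA.
    have [|[u uE]|//] := ap (v 0 (rshift l 0)) (h 0 i).
      by rewrite -v0; apply/dividesMl/dividesxx.
    exists (const_mx u); apply: row_eq => [j|]; last by rewrite relation_right mxE.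
    by rewrite relation_left mxE; apply: (mulIf a0); rewrite v0 uE mulrAC.
  rewrite /= /presentation; set x := presentation_row _ _ _.
  suff -> : x = 0 by rewrite mul0mx.
  apply/rowP=> i; rewrite [LHS]mxE relation_left relation_right [RHS]mxE.
  by rewrite mulrAC !rmorphM /= mulfK // subrr.
- exact: log_form1_presentation.
(* Minimality: the [h 0 i] have no constant term by assumption, and [a] is homogeneous of degree
   1. *)
move=> u j; rewrite -[j]splitK; case: split => i /=.
  by rewrite relation_left rmorphM /= h00 mulr0.
rewrite [i]ord1 relation_right rmorphM /=.
rewrite (dhomog_nemf_coeff (linear_poly_homog _)) ?mulr0 //=.
by rewrite mdeg0.
Qed.

End DualSPOG.

Local Open Scope fset_scope.

Theorem theorem1p5 (K : fieldType) (l : nat) (A : {fset {vspace 'rV[K]_l}})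
    (alpha : {vspace 'rV[K]_l} -> 'Hom('rV[K]_l, K^o)) (H : {vspace 'rV[K]_l}) :
  central_arrangement A ->
  defining_forms A alpha ->
  H \in A ->
  free_arrangement alpha (A `\ H) ->
  free_arrangement alpha A \/ dual_SPOG alpha A.
Proof.
move=> cA dA HA /(log_der_deletion cA dA HA).
case=> k [E [h [e [hE E0 DE [h_ndiv h_deg h_prim]]]]].
have [h00|] := classic (forall i, (h 0 i)@_0%MM = 0).
  by right; apply: (dual_SPOG_presentation cA dA HA hE E0 DE h_ndiv h_deg h_prim).
(* By homogeneity this [h 0 i] is a nonzero constant, hence a unit. *)
case/not_all_ex_not=> i /eqP hi0; left.
apply: (free_congruence_submodule (i := i) _ E0 _ DE).
  by case: (form_prime cA dA HA).
exists (((h 0 i)@_0%MM)^-1)%:MP.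
rewrite [X in _ * X](poly_deg_const (h_deg i) hi0) -mpolyCM mulVf //.
Qed.
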